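(* One has $P=\mathrm{conv}(\mathcal W\cdot\mu_\rho)$. In particular, the weights of $\rho$ (viewed as elements of $\mathfrak a$ via $\langle\cdot,\cdot\rangle$) are contained in the convex hull of the Weyl group orbit through the highest weight $\mu_\rho$.
   Context: Let $G\subset \mathrm{SL}(n,\mathbb R)$ be a closed connected noncompact semisimple Lie subgroup with Lie algebra $\mathfrak g$ such that $G=K\exp(\mathfrak p)$, where $K=G\cap \mathrm{SO}(n)$, $\mathfrak p=\mathfrak g\cap \mathrm{Sym}_0(n)$ and $\mathrm{Sym}_0(n)$ is the space of trace-zero real symmetric $n\times n$ matrices; let $\mathfrak k$ be the Lie algebra of $K$. Denote by $\rho$ the inclusion $G\to\mathrm{SL}(n,\mathbb R)$, and assume that $G$ acts irreducibly on $\mathbb R^n$ and on $\mathbb C^n$. Let $U\subset\mathrm{SU}(n)$ be the compact connected semisimple subgroup with Lie algebra $\mathfrak u=\mathfrak k\oplus i\mathfrak p$, and let $U^{\mathbb C}\subset\mathrm{SL}(n,\mathbb C)$ be its complexification (the Zariski closure of $G$). $\mathcal O'$ denotes the unique compact $U^{\mathbb C}$-orbit in $\mathbb P(\mathbb C^n)$ and $\mathcal O$ the unique compact $G$-orbit in $\mathcal O'$; one has $\mathcal O\subset\mathbb P(\mathbb R^n)$. Fix an $\mathrm{Ad}(\mathrm{SU}(n))$-invariant scalar product $\langle\cdot,\cdot\rangle$ on $i\mathfrak{su}(n)\supset\mathfrak p$. The $G$-gradient map $\mu_{\mathfrak p}:\mathbb P(\mathbb C^n)\to\mathfrak p$ is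 defined by $\langle\mu_{\mathfrak p}([z]),\beta\rangle=\frac{z^*\beta z}{\|z\|^2}$ for all $\beta\in\mathfrak p$. Let $\mathfrak a\subset\mathfrak p$ be a maximal Abelian subalgebra, $\pi_{\mathfrak a}:\mathfrak p\to\mathfrak a$ the orthogonal projection, $\mu_{\mathfrak a}=\pi_{\mathfrak a}\circ\mu_{\mathfrak p}$, $\mathcal E=\mathrm{conv}(\mu_{\mathfrak p}(\mathcal O))$ and $P=\mathcal E\cap\mathfrak a=\mu_{\mathfrak a}(\mathcal O)$. The Weyl group $\mathcal W=N_K(\mathfrak a)=\{k\in K:\ \mathrm{Ad}(k)(\mathfrak a)=\mathfrak a\}$ acts on $\mathfrak a$ as a finite group of isometries. The weights of $\rho$ are the $\lambda\in\mathfrak a^*$ for which $\{v\in\mathbb R^n: Hv=\lambda(H)v\ \forall H\in\mathfrak a\}\neq 0$. Fix a base $\Pi$ of the restricted root system $\Delta(\mathfrak g,\mathfrak a)$. The highest weight $\mu_\rho$ is the weight such that every weight is of the form $\mu_\rho-\sum_{\alpha\in\Pi}c_\alpha\alpha$ with $c_\alpha\ge 0$ (equivalently, it is the restriction to $\mathfrak a$ of the highest weight of the $\mathfrak g^{\mathbb C}$-representation $\mathbb C^n$ for a compatible ordering). The same symbol $\mu_\rho$ denotes the vector of $\mathfrak a$ representing this functional with respect to $\langle\cdot,\cdot\rangle$. *)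

(* Defs.v *)
From HB Require Import structures.
From mathcomp Require Import all_boot all_order all_algebra.
From mathcomp Require Import complex spectral.
From mathcomp Require mpoly.
From mathcomp Require Import all_classical all_reals all_analysis.
Import Order.TTheory GRing.Theory Num.Theory.
Import numFieldTopology.Exports numFieldNormedType.Exports.

Set Implicit Arguments.
Unset Strict Implicit.
Unset Printing Implicit Defensive.

Local Open Scope classical_set_scope.
Local Open Scope ring_scope.
Local Open Scope sesquilinear_scope.

(* R[i] as an abstract [numClosedFieldType], so that it carries the topology
   induced by its norm. *)
Definition Cplx (R : realType) : numClosedFieldType := R[i].

(* The inclusion R -> C. *)
Definition toC (R : realType) (x : R) : Cplx R := real_complex R x.

Definition cmx (R : realType) (m n : nat) (A : 'M[R]_(m, n)) :
  'M[Cplx R]_(m, n) := map_mx (@toC R) A.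

Section MatrixGroups.
Variables (R : realType) (n : nat).
Implicit Types (A X Y : 'M[R]_n) (G K g p : set 'M[R]_n).

Definition expmx A : 'M[R]_n :=
  limn (series (fun k : nat => (k`!%:R : R)^-1 *: A ^+ k)).

Definition is_subgroup_SL G : Prop :=
  [/\ G 1%:M,
      (forall x y, G x -> G y -> G (x *m y)),
      (forall x, G x -> G (invmx x)) &
      (forall x, G x -> \det x = 1)].

(* For a closed subgroup G this is its Lie algebra. *)
Definition lie_algebra G : set 'M[R]_n :=
  [set X | forall t : R, G (expmx (t *: X))].

Definition bracket X Y : 'M[R]_n := X *m Y - Y *m X.

Definition derived_algebra (I : {vspace 'M[R]_n}) : {vspace 'M[R]_n} :=
  <<[seq bracket x y | x <- vbasis I, y <- vbasis I]>>%VS.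

Definition solvable_algebra (I : {vspace 'M[R]_n}) : Prop :=
  exists k, iter k derived_algebra I = 0%VS.

Definition is_ideal g (I : {vspace 'M[R]_n}) : Prop :=
  [set` I] `<=` g /\ forall x y, g x -> y \in I -> bracket x y \in I.

Definition semisimple_algebra g : Prop :=
  forall I : {vspace 'M[R]_n}, is_ideal g I -> solvable_algebra I -> I = 0%VS.

Definition orthogonal_part G : set 'M[R]_n :=
  G `&` [set x | x^T *m x = 1%:M /\ \det x = 1].

Definition symmetric_part G : set 'M[R]_n :=
  lie_algebra G `&` [set X | X^T = X /\ \tr X = 0].

Definition is_abelian (a : {vspace 'M[R]_n}) : Prop :=
  forall x y, x \in a -> y \in a -> bracket x y = 0.

Definition maximal_abelian_in p (a : {vspace 'M[R]_n}) : Prop :=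
  [/\ [set` a] `<=` p, is_abelian a &
      forall b : {vspace 'M[R]_n}, [set` b] `<=` p -> is_abelian b ->
        (a <= b)%VS -> b = a].

Definition normalizer K (a : {vspace 'M[R]_n}) : set 'M[R]_n :=
  [set k | K k /\ (fun X => k *m X *m invmx k) @` [set` a] = [set` a]].

Definition weyl_orbit K (a : {vspace 'M[R]_n}) (x : 'M[R]_n) : set 'M[R]_n :=
  [set k *m x *m invmx k | k in normalizer K a].

Definition convex_hull (S : set 'M[R]_n) : set 'M[R]_n :=
  smallest (@convex_set R 'M[R]_n) S.

End MatrixGroups.

Definition acts_irreducibly (F : fieldType) (n : nat) (S : set 'M[F]_n) : Prop :=
  (0 < n)%N /\
  forall W : {vspace 'cV[F]_n},
    (forall g v, S g -> v \in W -> g *m v \in W) -> W = 0%VS \/ W = fullv.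

(* Polynomials in the n * n matrix entries are evaluated at the vectorization
   of the matrix. For S inside SL(n) the closure stays inside SL(n), because
   det - 1 vanishes on S. *)
Definition zariski_closure (F : fieldType) (n : nat) (S : set 'M[F]_n) :
    set 'M[F]_n :=
  [set x | forall f : mpoly.mpoly (n * n) F,
     (forall y, S y -> mpoly.meval (fun i => mxvec y 0 i) f = 0) ->
     mpoly.meval (fun i => mxvec x 0 i) f = 0].

Section ProjectiveSpace.
Variables (R : realType) (n : nat).
Local Notation C := (Cplx R).

Definition nonzero_vectors : Type := [set z : 'cV[C]_n | z != 0].

Definition proportional (z w : nonzero_vectors) : bool :=
  `[< exists c : C, set_val z = c *: set_val w >].

Lemma proportional_refl : reflexive proportional.
Proof. by move=> z; apply/asboolP; exists 1; rewrite scale1r. Qed.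

Lemma proportional_sym : symmetric proportional.
Proof.
suff H z w : proportional z w -> proportional w z.
  by move=> z w; apply/idP/idP; exact: H.
move=> /asboolP[c zE]; apply/asboolP; exists c^-1.
have c0 : c != 0.
  apply/eqP => c0; move: zE; rewrite c0 scale0r => zE.
  by have : set_val z != 0 := set_valP z; rewrite zE eqxx.
by rewrite zE scalerA mulVf // scale1r.
Qed.

Lemma proportional_trans : transitive proportional.
Proof.
move=> w z u /asboolP[c zE] /asboolP[d wE]; apply/asboolP.
by exists (c * d); rewrite zE wE scalerA.
Qed.

Canonical proportional_equiv :=
  EquivRel proportional
    proportional_refl proportional_sym proportional_trans.

Definition projective_space :=
  quotient_topology {eq_quot proportional_equiv}%qT.

Definition pclass (z : nonzero_vectors) : projective_space :=
  (\pi_(projective_space) z)%qT.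

Definition orbit (S : set 'M[C]_n) (z : nonzero_vectors) :
    set projective_space :=
  [set pclass w | w in
    [set w : nonzero_vectors | exists2 g, S g & set_val w = g *m set_val z]].

Definition is_compact_orbit (S : set 'M[C]_n) (O : set projective_space) : Prop :=
  compact O /\ exists z, O = orbit S z.

End ProjectiveSpace.

Section GradientMap.
Variables (R : realType) (n : nat).
Local Notation C := (Cplx R).

(* i su(n): since su(n) consists of the traceless skew-Hermitian matrices,
   these are the traceless Hermitian ones. *)
Definition isu : set 'M[C]_n := [set A | A^t* = A /\ \tr A = 0].

Definition SU : set 'M[C]_n := [set u | u \is unitarymx /\ \det u = 1].

(* Only the restriction of [ip] to the real vector space i su(n) matters. *)
Record AdSU_scalar_product (ip : 'M[C]_n -> 'M[C]_n -> R) : Prop := {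
  ip_linear : forall (c : R) A B D, isu A -> isu B -> isu D ->
    ip (toC c *: A + B) D = c * ip A D + ip B D;
  ip_sym : forall A B, isu A -> isu B -> ip A B = ip B A;
  ip_pos : forall A, isu A -> A != 0 -> 0 < ip A A;
  ip_Ad : forall u A B, SU u -> isu A -> isu B ->
    ip (u *m A *m invmx u) (u *m B *m invmx u) = ip A B }.

(* For z != 0, the denominator is the squared Euclidean norm of z. This condition
   determines mu, since ip is positive definite on p. *)
Definition is_gradient_map (ip : 'M[C]_n -> 'M[C]_n -> R) (p : set 'M[R]_n)
    (mu : projective_space R n -> 'M[R]_n) : Prop :=
  (forall q, p (mu q)) /\
  forall (z : nonzero_vectors R n) (b : 'M[R]_n), p b ->
    toC (ip (cmx (mu (pclass z))) (cmx b)) =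
      ((set_val z)^t* *m cmx b *m set_val z) 0 0
        / \sum_i `|set_val z i 0| ^+ 2.

Definition momentum_polytope (mu : projective_space R n -> 'M[R]_n)
    (O : set (projective_space R n)) (a : {vspace 'M[R]_n}) : set 'M[R]_n :=
  convex_hull (mu @` O) `&` [set` a].

End GradientMap.

Section RestrictedRoots.
Variables (R : realType) (n : nat) (a : {vspace 'M[R]_n}).

(* The linear dual of a. *)
Local Notation dual := 'Hom(subvs_of a, R^o).

Definition is_weight (l : dual) : Prop :=
  exists2 v : 'cV[R]_n, v != 0 &
    forall H : subvs_of a, vsval H *m v = l H *: v.

Definition is_root (g : set 'M[R]_n) (r : dual) : Prop :=
  r != 0 /\
  exists2 X, g X /\ X != 0 &
    forall H : subvs_of a, bracket (vsval H) X = r H *: X.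

Definition is_base (g : set 'M[R]_n) (Pi : seq dual) : Prop :=
  [/\ free Pi,
      (forall r, r \in Pi -> is_root g r) &
      forall r, is_root g r -> exists c : dual -> nat,
        r = \sum_(s <- Pi) s *+ c s \/ r = - \sum_(s <- Pi) s *+ c s].

Definition is_highest_weight (Pi : seq dual) (m : dual) : Prop :=
  is_weight m /\
  forall l, is_weight l -> exists2 c : dual -> R,
    (forall s, s \in Pi -> 0 <= c s) & l = m - \sum_(s <- Pi) c s *: s.

Definition represents (ip : 'M[Cplx R]_n -> 'M[Cplx R]_n -> R)
    (x : 'M[R]_n) (l : dual) : Prop :=
  x \in a /\ forall H : subvs_of a, ip (cmx x) (cmx (vsval H)) = l H.

End RestrictedRoots.

(* Main.v *)
Require Import Defs.
From HB Require Import structures.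
From mathcomp Require Import all_boot all_order all_algebra.
From mathcomp Require Import perm complex spectral.
From mathcomp Require Import all_classical all_reals all_analysis.
From mathcomp Require Import ring lra.
Import Order.TTheory GRing.Theory Num.Theory.
Import numFieldTopology.Exports numFieldNormedType.Exports.
Set Implicit Arguments.
Unset Strict Implicit.
Unset Printing Implicit Defensive.
Local Open Scope classical_set_scope.
Local Open Scope ring_scope.
Local Open Scope sesquilinear_scope.

(** Write Ad(k) X for k X k^-1, g for the Lie algebra of G, p for its symmetric
part, K for the orthogonal part of G, mu for the gradient map and W for the
normalizer of a in K. Everything reduces to one inequality: for H in a regular
(distinct weights take distinct values at H), some q in the orbit of x_rho
under W satisfies l(H) <= <q, H> for every weight l ([weight_le_orbit]).

To prove it, fix a regular H' that is positive on the simple roots and choose k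
maximizing <Ad(k) H, H'> over the compact group K. The first-order condition
says that A = Ad(k) H commutes with H'; as H' is regular, A lies in a and k
normalizes a. The second-order condition along the rotation X - X^T given by a
root vector X of a root s says s(A) s(H') >= 0. So A is dominant
([exists_dominant_conj]). The element k carries l to a weight l', and l' is
the highest weight minus nonnegative multiples of simple roots, so that
l(H) = l'(A) <= mu_rho(A) = <Ad(k^-1) x_rho, H>.

A vector z of C^n is an orthogonal sum of weight vectors, hence z^* H z / |z|^2
is an average of the values l(H), and the inequality bounds the image of the
gradient map in the direction H. A point of a outside the convex hull of the
finite orbit of x_rho is strictly separated from it, by a regular H after a
small perturbation ([convex_hull_criterion]). This puts the weights, and the
part of conv(mu(O)) inside a, in that hull.

For the other inclusion it is enough to find in O a point [z] with z in the
highest weight space, since then mu([z]) = x_rho ([gradient_weight_vector]) and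
mu is K-equivariant ([gradient_equivariant]). The ratio |P z|^2 / |z|^2, with P
the orthogonal projection onto the highest weight space, attains its maximum on
the compact set O. The maximum is positive because the orbit spans C^n, and
exp(H') increases the ratio strictly unless it is 0 or 1. So it is 1 at a
maximum ([compact_orbit_weight]).

Three tools are built first: the exponential of matrices together with the fact
that the tangent vectors at 1 of a closed subgroup form a Lie algebra; the
identity <A, B> = c tr(AB) for every scalar product on Hermitian traceless
matrices invariant under SU(n), used to move symmetric matrices across
brackets; and the simultaneous diagonalization of a in a unitary basis. *)

(** * Limits of matrices *)

Lemma cvg_mxP (K : numFieldType) (T : Type) (F : set_system T) {FF : Filter F}
    m n (f : T -> 'M[K]_(m, n)) (M : 'M[K]_(m, n)) :
  (f @ F --> M) <-> (forall i j, (fun x => f x i j) @ F --> M i j).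
Proof.
split=> [fM i j|fM]; first exact: (cvg_comp f (fun N : 'M[K]_(m, n) => N i j) fM (@coord_continuous K m n i j M)).
apply/cvg_mx_entourageP => A entA.
suff : \forall x \near F, forall ij : 'I_m * 'I_n, (M ij.1 ij.2, f x ij.1 ij.2) \in A.
  by apply: filterS => x xA i j; exact: (xA (i, j)).
apply: filter_forall => -[i j] /=.
by have /cvg_app_entourageP /(_ A entA) := fM i j; apply: filterS => x; rewrite inE.
Qed.

Lemma cvg_sum (K : numFieldType) (V : normedModType K) (T : Type)
    (F : set_system T) {FF : Filter F} (I : Type) (r : seq I) (P : pred I)
    (f : I -> T -> V) (l : I -> V) :
  (forall i, P i -> f i @ F --> l i) ->
  (fun x => \sum_(i <- r | P i) f i x) @ F --> \sum_(i <- r | P i) l i.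
Proof.
move=> fl; elim: r => [|i r IH].
  by rewrite big_nil; under eq_fun do rewrite big_nil; exact: cvg_cst.
rewrite big_cons; under eq_fun do rewrite big_cons.
by case: ifP => // Pi; apply: cvgD => //; exact: fl.
Qed.

Section mx_analysis.
Variables (R : realType).

Lemma cvg_mulmx (T : Type) (F : set_system T) {FF : Filter F} m n p
   (f : T -> 'M[R]_(m, n)) (g : T -> 'M[R]_(n, p)) (A : 'M[R]_(m, n)) (B : 'M[R]_(n, p)) :
  f @ F --> A -> g @ F --> B -> (fun x => f x *m g x) @ F --> A *m B.
Proof.
move=> /cvg_mxP fA /cvg_mxP gB; apply/cvg_mxP => i j; rewrite mxE.
under eq_fun do rewrite mxE.
by apply: cvg_sum => k _; apply: cvgM; [exact: fA|exact: gB].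
Qed.

Lemma cvg_trmx (T : Type) (F : set_system T) {FF : Filter F} m n
   (f : T -> 'M[R]_(m, n)) (A : 'M[R]_(m, n)) : f @ F --> A -> (fun x => (f x)^T) @ F --> A^T.
Proof.
move=> /cvg_mxP fA; apply/cvg_mxP => i j; rewrite mxE.
under eq_fun do rewrite mxE.
exact: fA.
Qed.

Lemma cvg_mxtrace (T : Type) (F : set_system T) {FF : Filter F} n
   (f : T -> 'M[R]_n) (A : 'M[R]_n) : f @ F --> A -> (fun x => \tr (f x)) @ F --> \tr A.
Proof. by move=> /cvg_mxP fA; apply: cvg_sum => k _; exact: fA. Qed.

Variable n : nat.
Implicit Types A B X Y : 'M[R]_n.

Lemma mx_entry_norm m' n' (A : 'M[R]_(m', n')) i j : `|A i j| <= `|A|.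
Proof.
rewrite [leRHS]/Num.norm /= mx_normrE.
by apply/bigmax_geP; right; exists (i, j).
Qed.

Lemma mx_norm_le m' n' (A : 'M[R]_(m', n')) c : 0 <= c -> (forall i j, `|A i j| <= c) -> `|A| <= c.
Proof.
move=> c0 Ac; rewrite [leLHS]/Num.norm /= mx_normrE.
by apply/bigmax_leP; split => // -[i j] _; exact: Ac.
Qed.

Lemma mx_norm_mul A B : `|A *m B| <= n%:R * `|A| * `|B|.
Proof.
apply: mx_norm_le; first by rewrite !mulr_ge0.
move=> i j; rewrite mxE (le_trans (ler_norm_sum _ _ _)) //.
apply: (@le_trans _ _ (\sum_(k < n) `|A| * `|B|)).
  by apply: ler_sum => k _; rewrite normrM ler_pM // mx_entry_norm.
by rewrite sumr_const card_ord -mulrA mulr_natl.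
Qed.

Lemma mx_norm1_le : `|1%:M : 'M[R]_n| <= 1.
Proof.
by apply: mx_norm_le => // i j; rewrite mxE; case: (i == j); rewrite ?normr1 ?normr0.
Qed.

(** The norm of a matrix is its largest absolute entry, which is submultiplicative
only up to the factor [n]; this is why [n%:R * `|A|] plays the role of the
radius in every estimate on exponentials. *)
Lemma mx_norm_exp A k : `|A ^+ k| <= (n%:R * `|A|) ^+ k.
Proof.
elim: k => [|k IH]; first by rewrite !expr0 mx_norm1_le.
by rewrite !exprS (le_trans (mx_norm_mul _ _)) // ler_wpM2l // mulr_ge0.
Qed.

(** * The exponential of a matrix *)

Definition expmx_coeff A (k : nat) : 'M[R]_n := (k`!%:R : R)^-1 *: A ^+ k.

Lemma expmx_coeff_norm A k : `|expmx_coeff A k| <= exp_coeff (n%:R * `|A|) k.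
Proof.
rewrite normrZ normfV normr_nat mulrC ler_wpM2r ?invr_ge0 ?ler0n //.
exact: mx_norm_exp.
Qed.

Lemma cvg_expmx A : series (expmx_coeff A) @ \oo --> expmx A.
Proof.
suff : cvgn (series (expmx_coeff A)) by [].
have entry i j : cvgn (series (fun k => expmx_coeff A k i j)).
  apply: normed_cvg; apply: (@series_le_cvg _ _ (exp_coeff (n%:R * `|A|))).
  - by move=> k /=.
  - by move=> k; rewrite divr_ge0 // exprn_ge0 // mulr_ge0.
  - by move=> k; exact: le_trans (mx_entry_norm _ _ _) (expmx_coeff_norm A k).
  - exact: is_cvg_series_exp_coeff.
apply/cvg_ex; exists (\matrix_(i, j) limn (series (fun k => expmx_coeff A k i j))).
apply/cvg_mxP => i j; rewrite mxE.
rewrite (_ : (fun _ => _) = series (fun k => expmx_coeff A k i j)); first exact: entry.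
by apply/funext => N; rewrite /series /= summxE.
Qed.

(** Left, summation over the antidiagonals of the triangle i + j < N, as in the
partial sums of a Cauchy product; right, summation over its columns. *)
Lemma triangle_sum (V : zmodType) (F : nat -> nat -> V) N :
  \sum_(0 <= k < N) \sum_(0 <= i < k.+1) F (k - i)%N i =
  \sum_(0 <= i < N) \sum_(0 <= j < N | (i + j < N)%N) F j i.
Proof.
transitivity (\sum_(0 <= k < N) \sum_(0 <= i < N | (i <= k)%N) F (k - i)%N i).
  rewrite !big_nat; apply: eq_bigr => k /andP[_ kN].
  rewrite (big_nat_widen _ _ N) //; apply: eq_bigl => i.
under eq_bigr do rewrite big_mkcond.
rewrite exchange_big_nat /= !big_nat; apply: eq_bigr => i /andP[_ iN].
rewrite -big_mkcond /= (big_cat_nat (n := i)) //=; last exact: ltnW.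
rewrite big_nat_cond big_pred0 ?add0r; last first.
  by move=> k; rewrite andbC; case: leqP => // ik; rewrite ltnNge ik andbF.
rewrite -[X in \sum_(X <= _ < _ | _) _]add0n big_addn (big_nat_widen _ _ N) ?leq_subr //.
apply: eq_big => [j|j _]; first by rewrite leq_addl /= ltn_subRL.
by rewrite addnK.
Qed.

Lemma square_sum (V : zmodType) (F : nat -> nat -> V) N :
  \sum_(0 <= i < N) \sum_(0 <= j < N) F j i -
    \sum_(0 <= k < N) \sum_(0 <= i < k.+1) F (k - i)%N i =
  \sum_(0 <= i < N) \sum_(0 <= j < N | ~~ (i + j < N)%N) F j i.
Proof.
rewrite triangle_sum -sumrB; apply: eq_bigr => i _.
by rewrite (bigID (fun j => i + j < N)%N) /= addrAC subrr add0r.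
Qed.

Lemma expmx_coeffD A B k : A *m B = B *m A ->
  expmx_coeff (A + B) k = \sum_(0 <= i < k.+1) expmx_coeff A (k - i) *m expmx_coeff B i.
Proof.
move=> AB; rewrite /expmx_coeff exprDn_comm // big_mkord scaler_sumr.
apply: eq_bigr => i _; rewrite -scalemxAl -scalemxAr -[_ *+ 'C(k, i)]scaler_nat !scalerA.
congr (_ *: _); rewrite -(bin_fact (ltnSE (ltn_ord i))) !natrM.
have ? : ('C(k, i)%:R : R) != 0 by rewrite pnatr_eq0 -lt0n bin_gt0 -ltnS.
have ? : (i`!%:R : R) != 0 by rewrite pnatr_eq0 -lt0n fact_gt0.
have ? : ((k - i)`!%:R : R) != 0 by rewrite pnatr_eq0 -lt0n fact_gt0.
by field; apply/and3P.
Qed.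

Lemma exp_coeffD (a b : R) k :
  exp_coeff (a + b) k = \sum_(0 <= i < k.+1) exp_coeff a (k - i)%N * exp_coeff b i.
Proof.
rewrite /exp_coeff /= exprDn big_mkord mulr_suml; apply: eq_bigr => i _.
rewrite -mulr_natr -(bin_fact (ltnSE (ltn_ord i))) !natrM.
have ? : ('C(k, i)%:R : R) != 0 by rewrite pnatr_eq0 -lt0n bin_gt0 -ltnS.
have ? : (i`!%:R : R) != 0 by rewrite pnatr_eq0 -lt0n fact_gt0.
have ? : ((k - i)`!%:R : R) != 0 by rewrite pnatr_eq0 -lt0n fact_gt0.
by field; apply/and3P.
Qed.

(** Both differences are sums over the pairs i, j < N with i + j >= N, and the
matrix terms are dominated by the real ones. The right-hand side tends to
e^a e^b - e^(a+b) = 0, so the functional equation of the real exponential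
carries over to commuting matrices without rearranging infinite sums. *)
Lemma expmx_partialM A B (N : nat) : A *m B = B *m A ->
  `|series (expmx_coeff A) N *m series (expmx_coeff B) N - series (expmx_coeff (A + B)) N|
  <= n%:R * (series (exp_coeff (n%:R * `|A|)) N * series (exp_coeff (n%:R * `|B|)) N
     - series (exp_coeff (n%:R * `|A| + n%:R * `|B|)) N).
Proof.
move=> AB; rewrite /series /= mulmx_sumr [X in _ <= _ * (X - _)]mulr_sumr.
under [X in `|X - _|]eq_bigr do rewrite mulmx_suml.
under [X in `|_ - X|]eq_bigr do rewrite expmx_coeffD //.
under [X in _ <= _ * (X - _)]eq_bigr do rewrite mulr_suml.
under [X in _ <= _ * (_ - X)]eq_bigr do rewrite exp_coeffD.
rewrite (square_sum (fun j i => expmx_coeff A j *m expmx_coeff B i)).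
rewrite (square_sum (fun j i => exp_coeff (n%:R * `|A|) j * exp_coeff (n%:R * `|B|) i)).
rewrite (le_trans (ler_norm_sum _ _ _)) // mulr_sumr ler_sum // => i _.
rewrite (le_trans (ler_norm_sum _ _ _)) // mulr_sumr ler_sum // => j _.
rewrite (le_trans (mx_norm_mul _ _)) // -mulrA ler_wpM2l //.
by rewrite ler_pM // expmx_coeff_norm.
Qed.

Lemma expmxD A B : A *m B = B *m A -> expmx (A + B) = expmx A *m expmx B.
Proof.
move=> AB.
have lim1 : (series (expmx_coeff A) N *m series (expmx_coeff B) N) @[N --> \oo]
    --> expmx (A + B).
  set u := fun N => _.
  suff -> : u = (u \- series (expmx_coeff (A + B))) \+ series (expmx_coeff (A + B)).
    rewrite -[X in _ --> X]add0r; apply: cvgD; last exact: cvg_expmx.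
    apply/norm_cvg0P.
    set a := n%:R * `|A|; set b := n%:R * `|B|.
    apply: (@squeeze_cvgr _ _ _ _ (fun=> 0) (fun N => n%:R * (series (exp_coeff a) N *
        series (exp_coeff b) N - series (exp_coeff (a + b)) N))).
    - by apply: nearW => N; rewrite normr_ge0 expmx_partialM.
    - exact: cvg_cst.
    - rewrite -[X in _ --> X](mulr0 n%:R); apply: cvgM; first exact: cvg_cst.
      rewrite -[X in _ --> X](subrr (expR (a + b))) {1}expRD.
      by apply: cvgB; [apply: cvgM|]; exact: is_cvg_series_exp_coeff.
  by apply/funext => N /=; rewrite subrK.
by apply: (norm_cvg_unique lim1); apply: cvg_mulmx; exact: cvg_expmx.
Qed.

Lemma expmx0 : expmx (0 : 'M[R]_n) = 1%:M.
Proof.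
apply: (norm_cvg_unique (cvg_expmx (A := 0))).
apply: cvg_near_cst; exists 1%N => // N /= N0.
rewrite /series /= big_ltn // big_nat_cond big1 ?addr0.
  by rewrite /expmx_coeff expr0 invr1 scale1r.
by move=> [//|k] _; rewrite /expmx_coeff expr0n scaler0.
Qed.

Lemma expmxNK A : expmx (- A) *m expmx A = 1%:M.
Proof. by rewrite -expmxD ?addNr ?expmx0 // mulNmx mulmxN. Qed.

Lemma expmxKN A : expmx A *m expmx (- A) = 1%:M.
Proof. by rewrite -expmxD ?addrN ?expmx0 // mulNmx mulmxN. Qed.

Lemma expmxMn A k : expmx (k%:R *: A) = expmx A ^+ k.
Proof.
elim: k => [|k IH]; first by rewrite scale0r expmx0 expr0.
rewrite -natr1 scalerDl scale1r expmxD ?IH ?exprSr //.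
by rewrite -scalemxAl -scalemxAr.
Qed.

Lemma trmx_exp A k : (A ^+ k)^T = A^T ^+ k.
Proof.
elim: k => [|k IH]; first by rewrite !expr0 trmx1.
by rewrite exprS -mulmxE trmx_mul IH exprSr.
Qed.

Lemma expmx_tr A : (expmx A)^T = expmx A^T.
Proof.
have cA : (series (expmx_coeff A) N)^T @[N --> \oo] --> (expmx A)^T.
  by apply: cvg_trmx; exact: cvg_expmx.
apply: (norm_cvg_unique cA).
rewrite (_ : (fun _ => _) = series (expmx_coeff A^T)); first exact: cvg_expmx.
apply/funext => N; rewrite /series /= raddf_sum; apply: eq_bigr => k _.
by rewrite /expmx_coeff -trmx_exp; apply/matrixP => i j; rewrite !mxE.
Qed.

Lemma expmx_conj (P Q A : 'M[R]_n) : P *m Q = 1%:M -> Q *m expmx A *m P = expmx (Q *m A *m P).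
Proof.
move=> PQ.
have cA : (Q *m series (expmx_coeff A) N *m P) @[N --> \oo] --> Q *m expmx A *m P.
  apply: cvg_mulmx; last exact: cvg_cst.
  by apply: cvg_mulmx; [exact: cvg_cst|exact: cvg_expmx].
apply: (norm_cvg_unique cA).
rewrite (_ : (fun _ => _) = series (expmx_coeff (Q *m A *m P))); first exact: cvg_expmx.
apply/funext => N; rewrite /series /= mulmx_sumr mulmx_suml; apply: eq_bigr => k _.
rewrite /expmx_coeff -scalemxAr -scalemxAl; congr (_ *: _).
elim: k => [|k IH]; first by rewrite !expr0 mulmx1 (mulmx1C PQ).
rewrite !exprS -IH -!mulmxE !mulmxA; congr (_ *m _ *m _).
by rewrite -[RHS]mulmxA PQ mulmx1.
Qed.

Lemma expmx_eigen A (v : 'cV[R]_n) (l : R) : A *m v = l *: v -> expmx A *m v = expR l *: v.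
Proof.
move=> Av.
have cA : series (expmx_coeff A) N *m v @[N --> \oo] --> expmx A *m v.
  by apply: cvg_mulmx; [exact: cvg_expmx|exact: cvg_cst].
apply: (norm_cvg_unique cA).
rewrite (_ : (fun _ => _) = (fun N => series (exp_coeff l) N *: v)).
  by apply: cvgZ; [exact: is_cvg_series_exp_coeff|exact: cvg_cst].
apply/funext => N; rewrite /series /= mulmx_suml scaler_suml; apply: eq_bigr => k _.
rewrite /expmx_coeff -scalemxAl /exp_coeff /= mulrC -scalerA; congr (_ *: _).
elim: k => [|k IH]; first by rewrite !expr0 mul1mx scale1r.
by rewrite exprSr -mulmxE -mulmxA Av -scalemxAr IH scalerA exprS.
Qed.

Lemma expmx_approx A : `|expmx A - 1%:M - A| <= (n%:R * `|A|) ^+ 2 * expR (n%:R * `|A|).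
Proof.
set a := n%:R * `|A|; have a0 : 0 <= a by rewrite mulr_ge0.
have cA : (series (expmx_coeff A) N - 1%:M - A) @[N --> \oo] --> expmx A - 1%:M - A.
  by apply: cvgB; [apply: cvgB; [exact: cvg_expmx|]|]; exact: cvg_cst.
have cN : `|series (expmx_coeff A) N - 1%:M - A| @[N --> \oo] --> `|expmx A - 1%:M - A|.
  exact: cvg_norm.
apply: (cvgr_to_le cN).
exists 2%N => // N /= N2.
rewrite /series /= big_ltn ?(leq_trans _ N2) // big_ltn //.
rewrite {1}/expmx_coeff expr0 invr1 scale1r [1%:M + _]addrC addrK.
rewrite {1}/expmx_coeff expr1 invr1 scale1r [A + _]addrC addrK.
rewrite (le_trans (ler_norm_sum _ _ _)) //.
rewrite -[2%N]add0n big_addn.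
apply: (@le_trans _ _ (a ^+ 2 * series (exp_coeff a) (N - 2)%N)).
  rewrite /series /= mulr_sumr ler_sum // => k _.
  rewrite (le_trans (expmx_coeff_norm _ _)) // -/a /exp_coeff /= mulrA -exprD addnC.
  rewrite ler_wpM2l ?exprn_ge0 // lef_pV2 ?posrE ?ltr0n ?fact_gt0 // ler_nat.
  by rewrite (_ : 2 + k = k.+2)%N // !factS mulnA leq_pmull.
rewrite add0n ler_wpM2l ?exprn_ge0 // /expR.
apply: nondecreasing_cvgn_le; last exact: is_cvg_series_exp_coeff.
by apply: nondecreasing_series => k _ _; rewrite exp_coeff_ge0.
Qed.
End mx_analysis.

(** * The Lie algebra of a closed subgroup *)

Section tangent.
Variables (R : realType) (n : nat).
Implicit Types (A B X Y : 'M[R]_n) (e : nat -> R).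

Lemma expmx_quotient e X : (forall m, e m != 0) -> e @ \oo --> (0 : R) ->
  (e m)^-1 *: (expmx (e m *: X) - 1%:M) @[m --> \oo] --> X.
Proof.
move=> e0 ecvg; set q := fun m => _.
suff : q m - X @[m --> \oo] --> (0 : 'M[R]_n).
  move=> qX; have -> : q = (q \- (fun=> X)) \+ (fun=> X).
    by apply/funext => m /=; rewrite subrK.
  by rewrite -[X in _ --> X]add0r; apply: cvgD; [exact: qX|exact: cvg_cst].
apply/norm_cvg0P; set a := n%:R * `|X|.
have ecvg' : `|e m| @[m --> \oo] --> (0 : R) by apply/norm_cvg0P.
apply: (@squeeze_cvgr _ _ _ _ (fun=> 0) (fun m => `|e m| * (a ^+ 2 * expR (`|e m| * a)))).
- apply: nearW => m; rewrite normr_ge0 /=.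
  have -> : q m - X = (e m)^-1 *: (expmx (e m *: X) - 1%:M - e m *: X).
    by rewrite scalerBr scalerK.
  rewrite normrZ normfV ler_pdivrMl ?normr_gt0 //.
  apply: le_trans (expmx_approx _) _; rewrite normrZ mulrCA -/a.
  by rewrite exprMn expr2 !mulrA.
- exact: cvg_cst.
- rewrite -[X in _ --> X](mul0r (a ^+ 2 * expR (0 * a))); apply: cvgM => //.
  apply: cvgM; first exact: cvg_cst.
  apply: continuous_cvg; first exact: continuous_expR.
  by apply: cvgM => //; exact: cvg_cst.
Qed.

Lemma expmx_cvg1 e X : (forall m, e m != 0) -> e @ \oo --> (0 : R) ->
  expmx (e m *: X) @[m --> \oo] --> (1%:M : 'M[R]_n).
Proof.
move=> e0 ecvg.
have -> : (fun m => expmx (e m *: X)) =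
    (fun m => e m *: ((e m)^-1 *: (expmx (e m *: X) - 1%:M)) + 1%:M).
  by apply/funext => m; rewrite scalerKV // subrK.
rewrite -[X in _ --> X]add0r -(scale0r X); apply: cvgD; last exact: cvg_cst.
by apply: cvgZ => //; exact: expmx_quotient.
Qed.

(** Near the identity the crude bound [mx_norm_mul] would cost a factor [n] for each
multiplication; splitting off the identity keeps powers under control. *)
Lemma mx_norm_mul1D (D M : 'M[R]_n) : `|(1%:M + D) *m M| <= (1 + n%:R * `|D|) * `|M|.
Proof.
rewrite mulmxDl mul1mx (le_trans (ler_normD _ _)) // mulrDl mul1r lerD2l.
exact: mx_norm_mul.
Qed.

Lemma mx_norm_exp1D (D : 'M[R]_n) k : `|(1%:M + D) ^+ k| <= (1 + n%:R * `|D|) ^+ k.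
Proof.
elim: k => [|k IH]; first by rewrite !expr0 mx_norm1_le.
by rewrite !exprS (le_trans (mx_norm_mul1D _ _)) // ler_wpM2l.
Qed.

Lemma mx_norm_expB (D E : 'M[R]_n) k :
  `|(1%:M + D) ^+ k - (1%:M + E) ^+ k| <=
  n%:R * (1 + n%:R * `|D|) ^+ k * (1 + n%:R * `|E|) ^+ k * (k%:R * `|D - E|).
Proof.
set a := 1 + _ * `|D|; set b := 1 + _ * `|E|.
have a1 : 1 <= a by rewrite lerDl mulr_ge0.
have b1 : 1 <= b by rewrite lerDl mulr_ge0.
have a0 := le_trans ler01 a1; have b0 := le_trans ler01 b1.
elim: k => [|k IH]; first by rewrite !expr0 subrr normr0 !mul0r !mulr0.
set A := 1%:M + D; set B := 1%:M + E.
have -> : A ^+ k.+1 - B ^+ k.+1 = A *m (A ^+ k - B ^+ k) + (D - E) *m B ^+ k.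
  rewrite mulmxBr !exprS -!mulmxE (_ : D - E = A - B); last first.
    by rewrite /A /B opprD addrACA subrr add0r.
  by rewrite mulmxBl addrA subrK.
rewrite (le_trans (ler_normD _ _)) // -natr1 mulrDl mul1r mulrDr lerD //.
  rewrite (le_trans (mx_norm_mul1D _ _)) // -/a (le_trans (ler_wpM2l a0 IH)) //.
  rewrite [leLHS]mulrA ler_wpM2r ?mulr_ge0 //.
  rewrite !exprS !mulrA [a * n%:R]mulrC ler_wpM2r ?exprn_ge0 //.
  by rewrite ler_peMr // !mulr_ge0 // exprn_ge0.
rewrite (le_trans (mx_norm_mul _ _)) //.
rewrite mulrAC ler_wpM2r // -mulrA ler_wpM2l // (le_trans (mx_norm_exp1D _ _)) // -/b.
rewrite -[leLHS]mul1r ler_pM ?exprn_ge0 ?exprn_ege1 //.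
by rewrite exprS ler_peMl // exprn_ge0.
Qed.

(** This generalizes (1 + x/m)^m -> e^x: a sequence that leaves 1 with velocity X
has the same powers in the limit as exp(X / m), because the difference of the
m-th powers is at most m times the difference times a bounded factor. *)
Lemma expmx_tangent (f : nat -> 'M[R]_n) X :
  m.+1%:R *: (f m - 1%:M) @[m --> \oo] --> X -> f m ^+ m.+1 @[m --> \oo] --> expmx X.
Proof.
move=> fX; pose g m := expmx (m.+1%:R^-1 *: X).
have gX : m.+1%:R *: (g m - 1%:M) @[m --> \oo] --> X.
  have e0 (m : nat) : (m.+1%:R^-1 : R) != 0 by rewrite invr_eq0 pnatr_eq0.
  have := expmx_quotient (X := X) e0 cvg_harmonic.
  by under eq_fun do rewrite invrK.
have gE m : g m ^+ m.+1 = expmx X.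
  by rewrite -expmxMn scalerA divff ?pnatr_eq0 // scale1r.
suff : f m ^+ m.+1 - g m ^+ m.+1 @[m --> \oo] --> (0 : 'M[R]_n).
  move=> fg; have -> : (fun m => f m ^+ m.+1) =
      (fun m => f m ^+ m.+1 - g m ^+ m.+1) \+ (fun=> expmx X).
    by apply/funext => m /=; rewrite gE subrK.
  by rewrite -[X in _ --> X]add0r; apply: cvgD; [exact: fg|exact: cvg_cst].
apply/norm_cvg0P.
pose x m := `|m.+1%:R *: (f m - 1%:M)|; pose y m := `|m.+1%:R *: (g m - 1%:M)|.
apply: (@squeeze_cvgr _ _ _ _ (fun=> 0) (fun m => n%:R * expR (n%:R * x m) *
   expR (n%:R * y m) * `|m.+1%:R *: (f m - 1%:M) - m.+1%:R *: (g m - 1%:M)|)).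
- apply: nearW => m; rewrite normr_ge0 /=.
  have expB (D : 'M[R]_n) : (1 + n%:R * `|D|) ^+ m.+1 <= expR (n%:R * `|m.+1%:R *: D|).
    rewrite normrZ normr_nat mulrCA expRM_natl.
    by rewrite lerXn2r ?nnegrE ?expR_ge0 ?addr_ge0 ?mulr_ge0 // expR_ge1Dx.
  have := mx_norm_expB (f m - 1%:M) (g m - 1%:M) m.+1.
  rewrite ![1%:M + _]addrC !subrK => /le_trans; apply.
  rewrite -scalerBr normrZ normr_nat ler_wpM2r ?mulr_ge0 //.
  by rewrite -!mulrA ler_wpM2l // ler_pM ?exprn_ge0 ?addr_ge0 ?mulr_ge0 // expB.
- exact: cvg_cst.
- rewrite -[X in _ --> X](mulr0 (n%:R * expR (n%:R * `|X|) * expR (n%:R * `|X|))).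
  have E (h : nat -> 'M[R]_n) : h @ \oo --> X ->
     expR (n%:R * `|h m|) @[m --> \oo] --> expR (n%:R * `|X|).
    move=> hX; apply: continuous_cvg; first exact: continuous_expR.
    by apply: cvgM; [exact: cvg_cst|exact: cvg_norm].
  apply: cvgM.
    by apply: cvgM; [apply: cvgM; [exact: cvg_cst|exact: E]|exact: E].
  rewrite -(normr0 'M[R]_n) -(subrr X); apply: cvg_norm; exact: cvgB.
Qed.

End tangent.

Section lie_algebra.
Variables (R : realType) (n : nat) (G : set 'M[R]_n).
Hypotheses (subG : is_subgroup_SL G) (closedG : closed G).
Implicit Types (A B X Y : 'M[R]_n).

Lemma subgroup_exp A k : G A -> G (A ^+ k).
Proof.
case: subG => G1 GM _ _ GA; elim: k => [|k IH]; first by rewrite expr0.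
by rewrite exprS; exact: GM.
Qed.

(** The only place where closedness produces elements of the group: a velocity of
elements of G at 1 exponentiates into G. Sums and brackets of elements of the
Lie algebra are such velocities. *)
Lemma closed_tangent (f : nat -> 'M[R]_n) X : (forall m, G (f m)) ->
  m.+1%:R *: (f m - 1%:M) @[m --> \oo] --> X -> G (expmx X).
Proof.
move=> Gf /expmx_tangent; apply: closed_cvg => //.
by apply: nearW => m; exact: subgroup_exp.
Qed.

Lemma lie_algebra_exp X : lie_algebra G X -> G (expmx X).
Proof. by move=> /(_ 1); rewrite scale1r. Qed.

Lemma lie_algebraZ (c : R) X : lie_algebra G X -> lie_algebra G (c *: X).
Proof. by move=> gX t; rewrite scalerA. Qed.

Lemma lie_algebraN X : lie_algebra G X -> lie_algebra G (- X).
Proof. by rewrite -scaleN1r; exact: lie_algebraZ. Qed.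

Let e (m : nat) : R := m.+1%:R^-1.
Let e_neq0 m : e m != 0. Proof. by rewrite invr_eq0 pnatr_eq0. Qed.
Let e_cvg : e @ \oo --> (0 : R). Proof. exact: cvg_harmonic. Qed.

Lemma lie_algebraD X Y : lie_algebra G X -> lie_algebra G Y -> lie_algebra G (X + Y).
Proof.
move=> gX gY t; rewrite scalerDr.
move: (lie_algebraZ t gX) (lie_algebraZ t gY) => {gX gY}.
move: (t *: X) (t *: Y) => {t} {}X {}Y gX gY.
have [_ GM _ _] := subG.
apply: (@closed_tangent (fun m => expmx (e m *: X) *m expmx (e m *: Y))).
  by move=> m; apply: GM; [exact: gX|exact: gY].
pose q (Z : 'M[R]_n) m := m.+1%:R *: (expmx (e m *: Z) - 1%:M).
have qZ (Z : 'M[R]_n) : q Z @ \oo --> Z.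
  have := expmx_quotient (X := Z) e_neq0 e_cvg.
  by rewrite /e; under eq_fun do rewrite invrK.
have -> : (fun m => m.+1%:R *: (expmx (e m *: X) *m expmx (e m *: Y) - 1%:M)) =
    (fun m => q X m *m expmx (e m *: Y) + q Y m).
  apply/funext => m; rewrite /q -scalemxAl -scalerDr mulmxBl mul1mx.
  by rewrite addrA subrK.
apply: cvgD => //; rewrite -[X in _ --> X]mulmx1; apply: cvg_mulmx => //.
exact: expmx_cvg1.
Qed.

(** With d^2 = 1/(m+1), the group commutator of exp(d X) and exp(d Y) differs from 1
by the commutator of exp(d X) - 1 and exp(d Y) - 1, up to factors that tend
to 1, so it leaves 1 with velocity [X, Y] in the parameter d^2. *)
Lemma expmx_bracket X Y : lie_algebra G X -> lie_algebra G Y -> G (expmx (bracket X Y)).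
Proof.
move=> gX gY; have [_ GM _ _] := subG.
pose d m := Num.sqrt (e m).
have e_gt0 m : 0 < e m by rewrite invr_gt0 ltr0n.
have d_neq0 m : d m != 0 by rewrite gt_eqF // sqrtr_gt0.
have d_cvg : d @ \oo --> (0 : R).
  by rewrite -(sqrtr0 R); apply: continuous_cvg => //; exact: sqrt_continuous.
pose x m := expmx (d m *: X); pose y m := expmx (d m *: Y).
pose x' m := expmx (d m *: - X); pose y' m := expmx (d m *: - Y).
apply: (@closed_tangent (fun m => x m *m y m *m (x' m *m y' m))).
  by move=> m; apply: (GM); apply: (GM); rewrite /x' /y' ?scalerN -?scaleNr; [exact: gX|exact: gY|exact: gX|exact: gY].
pose q (Z : 'M[R]_n) m := (d m)^-1 *: (expmx (d m *: Z) - 1%:M).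
have qZ (Z : 'M[R]_n) : q Z @ \oo --> Z by exact: expmx_quotient.
have -> : (fun m => m.+1%:R *: (x m *m y m *m (x' m *m y' m) - 1%:M)) =
    (fun m => (q X m *m q Y m - q Y m *m q X m) *m (x' m *m y' m)).
  apply/funext => m; rewrite /q -!scalemxAl -!scalemxAr -!scalerBr -!scalemxAl scalerA.
  rewrite -invfM (_ : d m * d m = e m) ?invrK; last first.
    by rewrite -expr2 sqr_sqrtr // ltW.
  congr (_ *: _); rewrite -/(x m) -/(y m).
  have xx' : x m *m x' m = 1%:M by rewrite /x /x' scalerN expmxKN.
  have yy' : y m *m y' m = 1%:M by rewrite /y /y' scalerN expmxKN.
  move: (x m) (y m) (x' m) (y' m) xx' yy' => A B A' B' AA' BB'.
  have BA : B *m A *m (A' *m B') = 1%:M.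
    by rewrite mulmxA -[B *m A *m A']mulmxA AA' mulmx1.
  rewrite -{1}BA -mulmxBl; congr (_ *m _).
  rewrite !mulmxBr !mulmxBl !mul1mx !mulmx1.
  by rewrite opprB !opprD !opprK; apply/matrixP => i j; rewrite !mxE; ring.
have -> : bracket X Y = (X *m Y - Y *m X) *m (1%:M *m 1%:M) by rewrite !mulmx1.
by apply: cvg_mulmx; [apply: cvgB; exact: cvg_mulmx|apply: cvg_mulmx; exact: expmx_cvg1].
Qed.

Lemma bracketZl (c : R) X Y : bracket (c *: X) Y = c *: bracket X Y.
Proof. by rewrite /bracket -scalemxAl -scalemxAr scalerBr. Qed.

Lemma lie_algebra_bracket X Y : lie_algebra G X -> lie_algebra G Y ->
  lie_algebra G (bracket X Y).
Proof. by move=> gX gY t; rewrite -bracketZl; apply: expmx_bracket => //; exact: lie_algebraZ. Qed.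

Lemma lie_algebra_Ad k X : G k -> lie_algebra G X -> lie_algebra G (k *m X *m invmx k).
Proof.
case: subG => _ GM GV Gdet Gk gX t.
have uk : k \in unitmx by rewrite unitmxE (Gdet _ Gk) unitr1.
rewrite scalemxAl scalemxAr -(@expmx_conj _ _ (invmx k)) ?mulVmx //.
by apply: (GM); [apply: (GM) => //; exact: gX|exact: GV].
Qed.
End lie_algebra.

(** * Real matrices as complex matrices *)

Section toC.
Variable R : realType.
Local Notation C := (Cplx R).

HB.instance Definition _ := GRing.isZmodMorphism.Build R C (@toC R)
  (rmorphB (real_complex R)).
HB.instance Definition _ := GRing.isMonoidMorphism.Build R C (@toC R)
  (rmorphism_monoidP (real_complex R)).

Lemma toC_real (x : R) : toC x \is Num.real.
Proof. by apply/complex_realP; exists x. Qed.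

Lemma conj_toC (x : R) : Num.conj (toC x) = toC x.
Proof. exact/CrealP/toC_real. Qed.

Lemma toC_inj : injective (@toC R).
Proof. exact: complexI. Qed.

Lemma ler_toC (x y : R) : (toC x <= toC y) = (x <= y).
Proof. exact: lecR. Qed.

Lemma toC_Re (z : C) : z \is Num.real -> toC (complex.Re z) = z.
Proof. exact: RRe_real. Qed.
End toC.

Section cmx.
Variable R : realType.
Lemma cmxM m n p (A : 'M[R]_(m, n)) (B : 'M[R]_(n, p)) : cmx (A *m B) = cmx A *m cmx B.
Proof. exact: map_mxM. Qed.
Lemma cmxD m n (A B : 'M[R]_(m, n)) : cmx (A + B) = cmx A + cmx B.
Proof. exact: map_mxD. Qed.
Lemma cmxB m n (A B : 'M[R]_(m, n)) : cmx (A - B) = cmx A - cmx B.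
Proof. exact: map_mxB. Qed.
Lemma cmxZ m n c (A : 'M[R]_(m, n)) : cmx (c *: A) = toC c *: cmx A.
Proof. exact: map_mxZ. Qed.
Lemma cmx_adj m n (A : 'M[R]_(m, n)) : (cmx A)^t* = cmx A^T.
Proof. by apply/matrixP => i j; rewrite !mxE conj_toC. Qed.
Lemma cmx1 n : cmx (1%:M : 'M[R]_n) = 1%:M.
Proof. exact: map_mx1. Qed.
Lemma cmx_trace n (A : 'M[R]_n) : \tr (cmx A) = toC (\tr A).
Proof. by rewrite trace_map_mx. Qed.
Lemma cmx_inj m n : injective (@cmx R m n).
Proof. by move=> A B /matrixP AB; apply/matrixP => i j; apply: toC_inj; have := AB i j; rewrite !mxE. Qed.
End cmx.

(** * Invariant scalar products on traceless Hermitian matrices *)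

Section ip.
Variables (R : realType) (n' : nat).
Local Notation n := n'.+1.
Local Notation C := (Cplx R).
Variable ip : 'M[C]_n -> 'M[C]_n -> R.
Hypothesis ipP : AdSU_scalar_product ip.
Implicit Types A B : 'M[C]_n.

Lemma isu0 : isu (0 : 'M[C]_n).
Proof. by split; rewrite ?trmx0 ?map_mx0 ?mxtrace0. Qed.

Lemma isuD A B : isu A -> isu B -> isu (A + B).
Proof.
move=> [A1 A2] [B1 B2]; split; last by rewrite mxtraceD A2 B2 addr0.
by rewrite linearD /= map_mxD A1 B1.
Qed.

Lemma isuZ (c : R) A : isu A -> isu (toC c *: A).
Proof.
move=> [A1 A2]; split; last by rewrite mxtraceZ A2 mulr0.
by rewrite linearZ /= map_mxZ A1; congr (_ *: _); exact: conj_toC.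
Qed.

Lemma isu_sum (I : Type) (r : seq I) (F : I -> 'M[C]_n) :
  (forall i, isu (F i)) -> isu (\sum_(i <- r) F i).
Proof.
by move=> isuF; elim/big_ind: _ => // [|A B]; [exact: isu0|exact: isuD].
Qed.

Lemma ipDl A B D : isu A -> isu B -> isu D -> ip (A + B) D = ip A D + ip B D.
Proof.
by move=> *; rewrite -[A]scale1r -(rmorph1 (@toC R)) (ip_linear ipP) // mul1r rmorph1 scale1r.
Qed.

Lemma ip0l D : isu D -> ip 0 D = 0.
Proof.
move=> D1; have := ipDl isu0 isu0 D1; rewrite addr0 => /eqP.
by rewrite -[X in X == _]addr0 (inj_eq (addrI _)) => /eqP.
Qed.

Lemma ipZl c A D : isu A -> isu D -> ip (toC c *: A) D = c * ip A D.
Proof.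
by move=> A1 D1; rewrite -[_ *: A]addr0 (ip_linear ipP) ?ip0l ?addr0 //; exact: isu0.
Qed.

Lemma ip_suml (I : Type) (r : seq I) (c : I -> R) (F : I -> 'M[C]_n) D :
  (forall i, isu (F i)) -> isu D ->
  ip (\sum_(i <- r) toC (c i) *: F i) D = \sum_(i <- r) c i * ip (F i) D.
Proof.
move=> isuF isuD'; elim: r => [|i r IH]; first by rewrite !big_nil ip0l.
rewrite !big_cons (ip_linear ipP) ?IH //.
by apply: isu_sum => j; exact: isuZ.
Qed.

Lemma ipC A B : isu A -> isu B -> ip A B = ip B A.
Proof. exact: ip_sym ipP A B. Qed.

(** Conjugation does not see scalars, and dividing u by an n-th root of its
determinant brings it into SU(n). *)
Lemma ip_unitary u A B : u \is unitarymx -> isu A -> isu B ->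
  ip (u *m A *m invmx u) (u *m B *m invmx u) = ip A B.
Proof.
move=> uu isuA isuB.
have uU : u \in unitmx by exact: unitarymx_unit.
have du : `|\det u| = 1.
  have /(congr1 (@determinant _ _)) := (unitarymxP uu).
  rewrite det_mulmx det_map_mx det_tr det1 => /eqP.
  by rewrite -normCK sqrp_eq1 ?normr_ge0 // => /eqP.
pose z := n.-root (\det u)^-1.
have zn : z ^+ n = (\det u)^-1 by rewrite rootCK.
have z1 : `|z| = 1.
  by apply/eqP; rewrite -(@pexpr_eq1 _ _ n) // -normrX zn normfV du invr1.
have z0 : z != 0 by rewrite -normr_gt0 z1.
have SUz : SU (z *: u).
  split; last by rewrite detZ zn mulVf // -unitfE -unitmxE.
  apply/unitarymxP; rewrite linearZ /= map_mxZ -scalemxAl -scalemxAr scalerA.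
  by rewrite -normCK z1 expr1n scale1r; exact/unitarymxP.
rewrite -[RHS](ip_Ad ipP SUz isuA isuB).
have E D : z *: u *m D *m invmx (z *: u) = u *m D *m invmx u.
  rewrite invmxZ ?unitmxZ ?unitfE // -!scalemxAl -scalemxAr scalerA mulfV //.
  by rewrite scale1r.
by rewrite !E.
Qed.

(** These span the traceless diagonal matrices, and the permutation matrices act on
them as the permutations of the pairs of indices. *)
Definition rootmx (i j : 'I_n) : 'M[C]_n := delta_mx i i - delta_mx j j.

Lemma isu_rootmx i j : isu (rootmx i j).
Proof.
split; last first.
  have tr1 k : \tr (delta_mx k k : 'M[C]_n) = 1.
    rewrite /mxtrace (bigD1 k) //= big1 ?addr0 ?mxE ?eqxx // => l lk.
    by rewrite mxE (negPf lk).
  by rewrite linearB /= !tr1 subrr.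
apply/matrixP => k l; rewrite !mxE rmorphB !rmorph_nat.
by rewrite ![(k == _) && _]andbC.
Qed.

Lemma perm_mx_unitary (s : 'S_n) : perm_mx s \is @unitarymx C n n.
Proof.
apply/unitarymxP; rewrite tr_perm_mx map_perm_mx -perm_mxM mulgV.
exact: perm_mx1.
Qed.

Lemma perm_conj_delta (s : 'S_n) i :
  perm_mx s *m delta_mx (s i) (s i) *m invmx (perm_mx s) = delta_mx i i :> 'M[C]_n.
Proof.
rewrite invmx_unitary ?perm_mx_unitary // tr_perm_mx map_perm_mx.
rewrite -row_permE -col_permE; apply/matrixP => k l.
by rewrite !mxE !(inj_eq perm_inj).
Qed.

Lemma perm_conj_rootmx (s : 'S_n) i j :
  perm_mx s *m rootmx (s i) (s j) *m invmx (perm_mx s) = rootmx i j.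
Proof. by rewrite mulmxBr mulmxBl !perm_conj_delta. Qed.

Lemma perm_2trans (i j k l : 'I_n) : i != j -> k != l ->
  exists s : 'S_n, s i = k /\ s j = l.
Proof.
move=> ij kl; pose t := tperm i k; pose j' := t j.
have j'k : j' != k by rewrite /j' -(tpermL i k) (inj_eq perm_inj) eq_sym.
exists (t * tperm j' l)%g; rewrite !permM tpermL -/j' tpermL; split=> //.
by rewrite tpermD // eq_sym.
Qed.

(** The symmetric group is transitive on ordered pairs of distinct indices. *)
Lemma ip_rootmx : exists2 q : R, 0 < q &
  forall i j, ip (rootmx i j) (rootmx i j) = q *+ (i != j).
Proof.
have r0 i : rootmx i i = 0 by rewrite /rootmx subrr.
have [[i [j ij]]|triv] := pselect (exists i j : 'I_n, i != j); last first.
  exists 1 => // i j; case: eqVneq => [->|ij]; first by rewrite r0 ip0l //; exact: isu0.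
  by case: triv; exists i, j.
exists (ip (rootmx i j) (rootmx i j)).
  apply: (ip_pos ipP); first exact: isu_rootmx.
  apply/eqP => /matrixP /(_ i i); rewrite !mxE eqxx (negPf ij) subr0.
  by move/eqP; rewrite oner_eq0.
move=> k l; case: eqVneq => [->|kl]; first by rewrite r0 ip0l //; exact: isu0.
have [s [<- <-]] := perm_2trans ij kl.
rewrite -(ip_unitary (perm_mx_unitary s)); try exact: isu_rootmx.
by rewrite perm_conj_rootmx.
Qed.

Lemma ip_sqrD A B : isu A -> isu B -> ip (A + B) (A + B) = ip A A + 2 * ip A B + ip B B.
Proof.
move=> A1 B1; have AB1 := isuD A1 B1.
rewrite (ipDl A1 B1 AB1) (ipC A1 AB1) (ipC B1 AB1) (ipDl A1 B1 A1) (ipDl A1 B1 B1).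
by rewrite (ipC B1 A1); ring.
Qed.

(** Polarization of rootmx i o - rootmx j o = rootmx i j. *)
Lemma ip_rootmx_polar q : (forall i j, ip (rootmx i j) (rootmx i j) = q *+ (i != j)) ->
  forall o i j, ip (rootmx i o) (rootmx j o) =
    q / 2 * ((i != o)%:R + (j != o)%:R - (i != j)%:R).
Proof.
move=> ipq o i j.
have E : rootmx i j = rootmx i o + toC (- 1) *: rootmx j o.
  by rewrite rmorphN1 scaleN1r /rootmx opprB addrA subrK.
have Fi := isu_rootmx i o; have Fj := isu_rootmx j o.
have Fj' := isuZ (- 1) Fj.
have := ipq i j; rewrite E (ip_sqrD Fi Fj') (ipC Fi Fj') !(ipZl (-1) Fj) //.
rewrite (ipC Fj Fj') (ipZl (-1) Fj) // (ipC Fj Fi) !ipq => H.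
have : 2 * ip (rootmx i o) (rootmx j o) = q *+ (i != o) + q *+ (j != o) - q *+ (i != j).
  by rewrite -H; ring.
rewrite -[q *+ (i != o)]mulr_natr -[q *+ (j != o)]mulr_natr -[q *+ (i != j)]mulr_natr.
lra.
Qed.

Lemma ip_diag q (d : 'I_n -> R) :
  (forall i j, ip (rootmx i j) (rootmx i j) = q *+ (i != j)) ->
  \sum_i d i = 0 ->
  let D := diag_mx (\row_i toC (d i)) in
  isu D /\ ip D D = q / 2 * \sum_i d i ^+ 2.
Proof.
move=> ipq d0 D; pose o : 'I_n := ord0.
have DE : D = \sum_i toC (d i) *: rootmx i o.
  rewrite /rootmx; under eq_bigr do rewrite scalerBr.
  rewrite sumrB -[X in _ - X]scaler_suml -rmorph_sum d0 rmorph0 scale0r subr0.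
  by rewrite /D diag_mx_sum_delta; apply: eq_bigr => i _; rewrite mxE.
have isuD' : isu D by rewrite DE; apply: isu_sum => i; exact/isuZ/isu_rootmx.
split=> //; rewrite {1}DE ip_suml //; last by move=> i; exact: isu_rootmx.
have F i := isu_rootmx i o.
transitivity (\sum_i \sum_j d i * d j * (q / 2 * ((i != o)%:R + (j != o)%:R - (i != j)%:R))).
  apply: eq_bigr => i _; rewrite ipC // DE ip_suml // mulr_sumr; apply: eq_bigr => j _.
  by rewrite (ip_rootmx_polar ipq) mulrA (eq_sym j i) [_%:R + _]addrC.
have z1 (f : 'I_n -> R) : \sum_i \sum_j d i * d j * f i = 0.
  by apply: big1 => i _; rewrite -mulr_suml -mulr_sumr d0 mulr0 mul0r.
have z2 (f : 'I_n -> R) : \sum_i \sum_j d i * d j * f j = 0.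
  rewrite exchange_big; apply: big1 => i _ /=.
  by rewrite -mulr_suml -mulr_suml d0 !mul0r.
transitivity (q / 2 * (\sum_i \sum_j d i * d j * (i != o)%:R + \sum_i \sum_j d i * d j * (j != o)%:R
   - \sum_i \sum_j d i * d j * (1 - (i == j)%:R))).
  rewrite -big_split /= -sumrB mulr_sumr; apply: eq_bigr => i _.
  rewrite -big_split /= -sumrB mulr_sumr; apply: eq_bigr => j _.
  by case: (i == j) => /=; ring.
rewrite z1 (z2 (fun j => (j != o)%:R)) add0r; congr (_ * _).
under eq_bigr do under eq_bigr do rewrite mulrBr.
under eq_bigr do rewrite sumrB.
rewrite sumrB (z1 (fun=> 1)) !sub0r opprK; apply: eq_bigr => i _.
rewrite (bigD1 i) //= eqxx mulr1 big1 ?addr0 ?expr2 // => j ji.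
by rewrite eq_sym (negPf ji) mulr0.
Qed.

(** By polarization it is enough to compare the quadratic forms, and a unitary
diagonalization reduces this to diagonal matrices. *)
Lemma ip_trace_isu : exists2 c : R, 0 < c &
  forall A B, isu A -> isu B -> toC (ip A B) = toC c * \tr (A *m B).
Proof.
have [q q0 ipq] := ip_rootmx; exists (q / 2); first by rewrite divr_gt0.
have sq A : isu A -> toC (ip A A) = toC (q / 2) * \tr (A *m A).
  move=> isuA; have [Ah At] := isuA.
  have Aherm : A \is hermsymmx by apply/is_hermitianmxP; rewrite expr0 scale1r Ah.
  have /orthomx_spectralP := hermitian_normalmx Aherm.
  set P := spectralmx A => AE.
  have uP : P \is unitarymx by exact: spectral_unitarymx.
  have PU : P \in unitmx by exact: unitarymx_unit.
  have spR := hermitian_spectral_diag_real Aherm.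
  pose d i := complex.Re (spectral_diag A 0 i).
  have dE : spectral_diag A = \row_i toC (d i).
    by apply/rowP => i; rewrite mxE toC_Re //; exact: (mxOverP spR).
  pose D := diag_mx (\row_i toC (d i)).
  have DE : D = P *m A *m invmx P.
    by rewrite AE !mulmxA mulmxV // mul1mx mulmxK // dE.
  have trD : \tr (D *m D) = \tr (A *m A).
    by rewrite DE !mulmxA mulmxKV // mxtrace_mulC !mulmxA mulVmx // mul1mx.
  have d0 : \sum_i d i = 0.
    apply: toC_inj; rewrite rmorph_sum rmorph0 -[RHS]At.
    have -> : \tr A = \tr D by rewrite DE mxtrace_mulC mulmxA mulVmx // mul1mx.
    by rewrite mxtrace_diag; apply: eq_bigr => i _; rewrite mxE.
  have [isuD' ipD] := ip_diag ipq d0.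
  rewrite -trD -(ip_unitary uP) // -DE ipD rmorphM rmorph_sum; congr (_ * _).
  by rewrite mulmx_diag mxtrace_diag; apply: eq_bigr => i _; rewrite !mxE rmorphXn expr2.
move=> A B A1 B1; have := sq _ (isuD A1 B1).
rewrite ip_sqrD // !rmorphD rmorphM /= !sq // mulmxDr !mulmxDl !mxtraceD [\tr (B *m A)]mxtrace_mulC.
rewrite !mulrDr => H; set x := toC (ip A B) in H *; set y := toC (q / 2) * \tr (A *m B) in H *.
have {H} : toC 2 * x = toC 2 * y.
  move/(congr1 (fun z => z - toC (q/2) * \tr (A *m A) - toC (q/2) * \tr (B *m B))): H.
  rewrite (rmorph_nat _ 2) => H; transitivity (toC (q/2) * \tr (A *m A) + 2 * x + toC (q/2) * \tr (B *m B) - toC (q/2) * \tr (A *m A) - toC (q/2) * \tr (B *m B)).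
    by ring.
  by rewrite H; ring.
by apply: mulfI; rewrite (rmorph_nat _ 2) pnatr_eq0.
Qed.

End ip.

Lemma ip_trace (R : realType) (n : nat) (ip : 'M[Cplx R]_n -> 'M[Cplx R]_n -> R) :
  (0 < n)%N -> AdSU_scalar_product ip -> exists2 c : R, 0 < c &
  forall A B : 'M[R]_n, A^T = A -> \tr A = 0 -> B^T = B -> \tr B = 0 ->
    ip (cmx A) (cmx B) = c * \tr (A *m B).
Proof.
case: n ip => // n ip _ /ip_trace_isu [c c0 H]; exists c => // A B A1 A2 B1 B2; apply: toC_inj.
rewrite H ?rmorphM -?cmxM ?cmx_trace //; split; rewrite ?cmx_adj ?A1 ?B1 //.
  by rewrite cmx_trace A2 rmorph0.
by rewrite cmx_trace B2 rmorph0.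
Qed.

(** * Simultaneous diagonalization of an abelian space of symmetric matrices *)

Lemma linear_hom (K : fieldType) (V W : vectType K) (f : V -> W) : linear f ->
  exists phi : 'Hom(V, W), forall x, phi x = f x.
Proof.
move=> flin; pose fL : {linear V -> W} := HB.pack f (GRing.isLinear.Build _ _ _ _ f flin).
by exists (linfun fL) => x; rewrite lfunE.
Qed.

Lemma cmx_rect (R : realType) m n (z : 'M[Cplx R]_(m, n)) :
  exists u w : 'M[R]_(m, n), z = cmx u + ('i%C : Cplx R) *: cmx w.
Proof.
exists (map_mx (@complex.Re R) z), (map_mx (@complex.Im R) z).
by apply/matrixP => i j; rewrite !mxE; exact: complexE.
Qed.

Lemma cmx_rect_inj (R : realType) m n (u w u' w' : 'M[R]_(m, n)) :
  cmx u + ('i%C : Cplx R) *: cmx w = cmx u' + ('i%C : Cplx R) *: cmx w' -> u = u' /\ w = w'.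
Proof.
have rectE (x y : R) : toC x + ('i%C : Cplx R) * toC y = (x +i* y)%C.
  by rewrite [RHS]complexE.
have reE (z : 'M[Cplx R]_(m, n)) (x y : 'M[R]_(m, n)) : z = cmx x + ('i%C : Cplx R) *: cmx y ->
    map_mx (@complex.Re R) z = x /\ map_mx (@complex.Im R) z = y.
  by move=> ->; split; apply/matrixP => i j; rewrite !mxE rectE.
by move=> E; have [<- <-] := reE _ _ _ E; have [-> ->] := reE _ _ _ (erefl (cmx u + 'i%C *: cmx w)).
Qed.

Lemma cmx_eigenP (R : realType) n (X : 'M[R]_n) (l : R) (u w : 'cV[R]_n) :
  cmx X *m (cmx u + ('i%C : Cplx R) *: cmx w) = toC l *: (cmx u + ('i%C : Cplx R) *: cmx w) <->
  X *m u = l *: u /\ X *m w = l *: w.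
Proof.
have lhsE : cmx X *m (cmx u + ('i%C : Cplx R) *: cmx w) =
    cmx (X *m u) + ('i%C : Cplx R) *: cmx (X *m w).
  by rewrite mulmxDr -scalemxAr -!cmxM.
have rhsE : toC l *: (cmx u + ('i%C : Cplx R) *: cmx w) =
    cmx (l *: u) + ('i%C : Cplx R) *: cmx (l *: w).
  rewrite scalerDr -!cmxZ; congr (_ + _).
  by rewrite cmxZ [LHS]scalerA [RHS]scalerA; congr (_ *: _); exact: mulrC.
rewrite lhsE rhsE; split=> [|[-> ->] //]; exact: cmx_rect_inj.
Qed.

Section codiag.
Variables (R : realType) (n : nat) (a : {vspace 'M[R]_n}).
Local Notation C := (Cplx R).
Local Notation dual := 'Hom(subvs_of a, R^o).

(** The columns of the adjoint of [Q] form an orthonormal basis of common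
eigenvectors, [lam j] being the weight of the j-th one, so that [Q *m z] is the
vector of coordinates of [z] in that basis. *)
Definition codiagonal (Q : 'M[C]_n) (lam : 'I_n -> dual) :=
  Q \is unitarymx /\ forall H : subvs_of a,
    Q *m cmx (vsval H) *m Q^t* = diag_mx (\row_j toC (lam j H)).

(** Commuting matrices are simultaneously triangular in some unitary basis, and a
triangular Hermitian matrix is diagonal and real. *)
Lemma exists_codiagonal : (forall H, H \in a -> H^T = H) -> is_abelian a ->
  exists Q lam, codiagonal Q lam.
Proof.
move=> asym aab.
have [|P uP /allP Ptrig] := @cotrigonalization C n [seq cmx x | x <- vbasis a].
  move=> _ _ /mapP[x xa ->] /mapP[y ya ->]; rewrite /comm_mx -!cmxM; congr cmx.
  by apply/eqP; rewrite -subr_eq0; apply/eqP; apply: aab; exact: vbasis_mem.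
have [M M_E] : exists M : 'M[R]_n -> 'M[C]_n, forall H, M H = P *m cmx H *m P^t*.
  by exists (fun H => P *m cmx H *m P^t*).
have MD c H K : M (c *: H + K) = toC c *: M H + M K.
  by rewrite !M_E cmxD cmxZ mulmxDr mulmxDl -scalemxAr -scalemxAl.
have MDe c H K i j : M (c *: H + K) i j = toC c * M H i j + M K i j.
  by rewrite MD; move: (M H) (M K) => X Y; rewrite !mxE.
have MCe H i j : (M H)^t* i j = (M H j i)^*.
  by move: (M H) => X; rewrite !mxE.
have Mherm H : H \in a -> (M H)^t* = M H.
  move=> Ha; rewrite M_E !trmx_mul !map_mxM /= cmx_adj asym // mulmxA; congr (_ *m _ *m _).
  by rewrite map_trmx trmxK -map_mx_comp map_mx_id // => z /=; rewrite conjCK.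
have Mdiag H : H \in a -> is_diag_mx (M H).
  move=> Ha; apply/is_diag_mxP => i j ij.
  have M0 : M 0 i j = 0.
    by rewrite M_E (_ : cmx 0 = 0) ?mulmx0 ?mul0mx ?mxE //; exact: map_mx0.
  rewrite (coord_vbasis Ha).
  elim/big_ind : _ => // [x y x0 y0|k _].
    by rewrite -[x]scale1r MDe x0 y0 mulr0 addr0.
  rewrite -[_ *: _]addr0 MDe M0 addr0.
  set x := (vbasis a)`_k.
  have xb : x \in vbasis a by rewrite mem_nth // size_tuple.
  have xa := vbasis_mem xb.
  have /is_trig_mxP Mtrig : is_trig_mx (M x).
    have := Ptrig (cmx x) (map_f _ xb).
    by rewrite /= /similar_to conjymx // M_E.
  apply/eqP; rewrite mulf_eq0; apply/orP; right; apply/eqP.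
  move: ij; rewrite neq_lt => /orP[ij|ji]; first exact: Mtrig.
  by rewrite -(Mherm _ xa) MCe Mtrig // rmorph0.
have Mreal H : H \in a -> forall j, M H j j \is Num.real.
  by move=> Ha j; apply/CrealP; rewrite -[in RHS](Mherm _ Ha) MCe.
pose f j (H : subvs_of a) : R^o := complex.Re (M (vsval H) j j).
have flin j : linear (f j).
  move=> c x y; apply: toC_inj; rewrite /f linearP MDe.
  rewrite toC_Re; last by rewrite -MDe -linearP; apply: Mreal; exact: subvsP.
  by rewrite rmorphD rmorphM /= !toC_Re //; apply: Mreal; exact: subvsP.
have /choice[lam lamE] := fun j => linear_hom (flin j).
exists P, lam; split=> // H; rewrite -M_E.
have /is_diag_mxP Md := Mdiag _ (subvsP H).
apply/matrixP => i j; rewrite [RHS]mxE [X in X *+ _]mxE.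
have [<-|ij] := eqVneq i j; last by rewrite Md.
by rewrite mulr1n lamE /f toC_Re // Mreal // subvsP.
Qed.

Section with_codiag.
Variables (Q : 'M[C]_n) (lam : 'I_n -> dual).
Hypothesis QP : codiagonal Q lam.
Implicit Types H : subvs_of a.

Lemma codiagonal_VK : Q^t* *m Q = 1%:M.
Proof. by case: QP => /unitarymxP /mulmx1C. Qed.

Lemma codiagonal_KV : Q *m Q^t* = 1%:M.
Proof. by case: QP => /unitarymxP. Qed.

Lemma codiagonal_mul H : Q *m cmx (vsval H) = diag_mx (\row_j toC (lam j H)) *m Q.
Proof. by case: QP => _ <-; rewrite -mulmxA codiagonal_VK mulmx1. Qed.

Lemma codiagonal_coord m H (z : 'M[C]_(n, m)) i j :
  (Q *m (cmx (vsval H) *m z)) i j = toC (lam i H) * (Q *m z) i j.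
Proof. by rewrite mulmxA codiagonal_mul -mulmxA mul_diag_mx mxE [X in X * _]mxE. Qed.

(** A weight vector has a nonzero coordinate in the eigenbasis. *)
Lemma codiagonal_weight l : is_weight l -> exists j, l = lam j.
Proof.
case=> v v0 lv; pose y := Q *m cmx v.
have [j yj] : exists j, y j 0 != 0.
  apply/existsP; apply: contraNT v0 => /existsPn y0.
  rewrite -(inj_eq (@cmx_inj R n 1)) -[cmx v]mul1mx -codiagonal_VK -mulmxA -/y.
  have -> : y = 0.
    by apply/matrixP => i k; rewrite ord1 [RHS]mxE; have := y0 i; rewrite negbK => /eqP.
  by rewrite mulmx0 (_ : cmx 0 = 0) //; exact: map_mx0.
exists j; apply/lfunP => H; apply: toC_inj; apply: (mulIf yj).
by rewrite -codiagonal_coord -cmxM lv cmxZ -scalemxAr [RHS]mxE.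
Qed.

Lemma codiagonal_col H j :
  cmx (vsval H) *m col j (Q^t*) = toC (lam j H) *: col j (Q^t*).
Proof.
have Qq : Q *m col j (Q^t*) = delta_mx j 0 by rewrite colE mulmxA codiagonal_KV mul1mx.
rewrite -[cmx _ *m _]mul1mx -codiagonal_VK -mulmxA [Q *m (_ *m _)]mulmxA.
rewrite codiagonal_mul -mulmxA Qq.
have -> : diag_mx (\row_j toC (lam j H)) *m delta_mx j 0 = toC (lam j H) *: delta_mx j 0 :> 'cV[C]_n.
  apply/matrixP => i k; rewrite ord1 mul_diag_mx !mxE.
  by case: eqVneq => [->|]; rewrite ?andbF ?mulr0.
by rewrite -scalemxAr -colE.
Qed.

(** The eigenvectors are complex, but their real and imaginary parts are
eigenvectors for the same real eigenvalues, and one of them is nonzero. *)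
Lemma is_weight_lam j : is_weight (lam j).
Proof.
pose q : 'cV[C]_n := col j (Q^t*).
have Qq : Q *m q = delta_mx j 0 by rewrite /q colE mulmxA codiagonal_KV mul1mx.
have qE H : cmx (vsval H) *m q = toC (lam j H) *: q by exact: codiagonal_col.
have q0 : q != 0.
  apply/eqP => q0; have := congr1 (fun M : 'cV[C]_n => M j 0) Qq.
  by rewrite q0 mulmx0 !mxE !eqxx /= => /eqP; rewrite eq_sym oner_eq0.
have [u [w quw]] := cmx_rect q.
have uwE H : vsval H *m u = lam j H *: u /\ vsval H *m w = lam j H *: w.
  by apply/cmx_eigenP; rewrite -quw.
have [u0|u0] := eqVneq u 0; last by exists u => // H; case: (uwE H).
exists w; last by move=> H; case: (uwE H).
apply: contraNneq q0 => w0.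
rewrite quw u0 w0 (_ : cmx 0 = 0) ?scaler0 ?addr0 //; exact: map_mx0.
Qed.

Lemma codiagonal_form H (z : 'cV[C]_n) :
  (z^t* *m cmx (vsval H) *m z) 0 0 = \sum_j toC (lam j H) * `|(Q *m z) j 0| ^+ 2.
Proof.
have adjM : (Q *m z)^t* = z^t* *m Q^t* by rewrite trmx_mul map_mxM.
rewrite -mulmxA -[z^t*]mulmx1 -codiagonal_VK [z^t* *m _]mulmxA -adjM -mulmxA mxE.
apply: eq_bigr => j _; rewrite codiagonal_coord mulrCA; congr (_ * _).
by rewrite 2!mxE mulrC -normCK.
Qed.

Lemma codiagonal_norm (z : 'cV[C]_n) :
  \sum_j `|(Q *m z) j 0| ^+ 2 = \sum_i `|z i 0| ^+ 2.
Proof.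
have normE (x : 'cV[C]_n) : \sum_i `|x i 0| ^+ 2 = (x^t* *m x) 0 0.
  by rewrite mxE; apply: eq_bigr => i _; rewrite normCK 2!mxE mulrC.
by rewrite !normE trmx_mul map_mxM -mulmxA [_ *m (Q *m z)]mulmxA codiagonal_VK mul1mx.
Qed.

Lemma codiagonal_expmx H m (z : 'M[C]_(n, m)) i j :
  (Q *m (cmx (expmx (vsval H)) *m z)) i j = toC (expR (lam i H)) * (Q *m z) i j.
Proof.
pose d := \row_j toC (expR (lam j H)).
suff expQ : cmx (expmx (vsval H)) *m Q^t* = Q^t* *m diag_mx d.
  rewrite -[cmx _]mulmx1 -codiagonal_VK !mulmxA -[Q *m _ *m _]mulmxA expQ.
  rewrite !mulmxA codiagonal_KV mul1mx -mulmxA mul_diag_mx mxE.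
  by rewrite [X in X * _]mxE.
apply/matrixP => k l; rewrite mul_mx_diag [RHS]mxE [X in _ * X]mxE mulrC.
have [u [w quw]] := cmx_rect (col l (Q^t*)).
have [uE wE] : vsval H *m u = lam l H *: u /\ vsval H *m w = lam l H *: w.
  by apply/cmx_eigenP; rewrite -quw; exact: codiagonal_col.
have : cmx (expmx (vsval H)) *m col l (Q^t*) = toC (expR (lam l H)) *: col l (Q^t*).
  by rewrite quw; apply/cmx_eigenP; split; exact: expmx_eigen.
rewrite [X in _ *m X]colE mulmxA -[_ *m delta_mx l 0]colE => /(congr1 (fun M : 'cV[C]_n => M k 0)).
by rewrite [LHS]mxE => ->; rewrite mxE [X in _ * X]mxE.
Qed.

(** Regularity is defined by the weights of the representation rather than by the
roots: the centralizer of such an H then preserves all weight spaces, which is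
what [regular_comm] extracts. *)
Definition regular H := forall i j, lam i H = lam j H -> lam i = lam j.

Lemma regular_comm H (A : 'M[R]_n) : regular H -> A *m vsval H = vsval H *m A ->
  forall K : subvs_of a, A *m vsval K = vsval K *m A.
Proof.
move=> regH AH K; apply: (@cmx_inj R n n); rewrite !cmxM.
have QK := codiagonal_VK; have KQ := codiagonal_KV.
(* conjugation by Q preserves products and is injective: compare entries there *)
have tr (X Y : 'M[C]_n) : Q *m (X *m Y) *m Q^t* = (Q *m X *m Q^t*) *m (Q *m Y *m Q^t*).
  by rewrite -!mulmxA [Q^t* *m (Q *m _)]mulmxA QK mul1mx.
have trI (X Y : 'M[C]_n) : Q *m X *m Q^t* = Q *m Y *m Q^t* -> X = Y.
  move=> /(congr1 (fun Z => Q^t* *m Z *m Q)).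
  by rewrite -!mulmxA QK !mulmx1 !mulmxA QK !mul1mx.
have D L : Q *m cmx (vsval L) *m Q^t* = diag_mx (\row_j toC (lam j L)) by case: QP.
apply: trI; rewrite !tr !D; move: (congr1 (@cmx R n n) AH) => {AH}.
rewrite !cmxM => /(congr1 (fun X => Q *m X *m Q^t*)); rewrite !tr !D.
move: (Q *m cmx A *m Q^t*) => B /matrixP BD; apply/matrixP => i j; have := BD i j.
have E1 L : (B *m diag_mx (\row_j toC (lam j L))) i j = toC (lam j L) * B i j.
  by rewrite mul_mx_diag mxE [X in _ * X]mxE mulrC.
have E2 L : (diag_mx (\row_j toC (lam j L)) *m B) i j = toC (lam i L) * B i j.
  by rewrite mul_diag_mx mxE [X in X * _]mxE.
rewrite !E1 !E2; have [->|b0] := eqVneq (B i j) 0; first by rewrite !mulr0.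
by move=> /(mulIf b0) /toC_inj /regH ->.
Qed.

End with_codiag.
End codiag.

(** * Regular and dominant elements *)

Lemma near_seq (T : Type) (I : eqType) (F : set_system T) {FF : Filter F} (s : seq I)
    (P : I -> T -> Prop) :
  (forall i, i \in s -> \forall t \near F, P i t) ->
  \forall t \near F, forall i, i \in s -> P i t.
Proof.
elim: s => [|i s IH] sP; first by apply: nearW.
have Pi := sP i (mem_head _ _).
have Ps : \forall t \near F, forall i, i \in s -> P i t.
  by apply: IH => j js; apply: sP; rewrite in_cons js orbT.
by apply: filterS2 Pi Ps => t Pit Pst j; rewrite in_cons => /orP[/eqP ->|]; [|exact: Pst].
Qed.

Section perturbation.
Variable R : realType.

Lemma near_small (c e : R) : 0 < e -> \forall t \near 0^'+, 0 < t /\ `|t * c| < e.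
Proof.
move=> e0; have c1 : 0 < `|c| + 1 by rewrite ltr_pwDr.
have := nbhs_right_lt (divr_gt0 e0 c1).
have := nbhs_right_gt (0 : R).
apply: filterS2 => t t0; rewrite ltr_pdivlMr // => te; split=> //.
rewrite normrM gtr0_norm // (le_lt_trans _ te) // ler_pM2l //.
by rewrite lerDl.
Qed.

Lemma near_affine_gt0 (b c : R) : 0 < b -> \forall t \near 0^'+, 0 < b + t * c.
Proof.
move=> b0; have := near_small c b0; apply: filterS => t [_].
by rewrite ltr_norml => /andP[]; lra.
Qed.

Lemma near_affine_neq0 (b c : R) : (b != 0) || (c != 0) -> \forall t \near 0^'+, b + t * c != 0.
Proof.
have [->/= c0|b0 _] := eqVneq b 0.
  have := nbhs_right_gt (0 : R); apply: filterS => t t0.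
  by rewrite add0r mulf_neq0 // gt_eqF.
have : 0 < `|b| by rewrite normr_gt0.
move=> /(near_small c); apply: filterS => t [_ tb].
by apply: contraTneq tb => /eqP; rewrite addrC addr_eq0 => /eqP ->; rewrite normrN ltxx.
Qed.

Variable (V : vectType R).
Local Notation dual := 'Hom(V, R^o).

Lemma homD_eval (f : dual) (x y : V) (t : R) : f (x + t *: y) = (f x : R) + t * f y.
Proof. by rewrite linearD linearZ. Qed.

(** If y is not in the kernel of the new functional, x + t y avoids all the kernels
for small t > 0. *)
Lemma exists_nonvanishing (s : seq dual) : (forall f, f \in s -> f != 0) ->
  exists x, forall f, f \in s -> f x != 0.
Proof.
elim: s => [|f s IH] s0; first by exists 0.
have [x xs] : exists x, forall g, g \in s -> g x != 0.
  by apply: IH => g gs; apply: s0; rewrite in_cons gs orbT.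
have [y fy] : exists y, f y != 0.
  have := s0 f (mem_head _ _); apply: contra_neqP => /forallNP fy.
  by apply/lfunP => y; rewrite lfunE /=; apply: contrapT => /eqP; exact: fy.
have /filter_ex[t tP] : \forall t \near 0^'+, forall g, g \in f :: s -> (g x : R) + t * g y != 0.
  apply: near_seq => g; rewrite in_cons => /orP[/eqP ->|/xs gx].
    by apply: near_affine_neq0; rewrite fy orbT.
  by apply: near_affine_neq0; rewrite gx.
by exists (x + t *: y) => g /tP; rewrite homD_eval.
Qed.

(** The matrix of the values of a free family of functionals on a basis is row free,
hence has a right inverse. *)
Lemma free_dual_ones (s : seq dual) : free s -> exists x, forall f, f \in s -> f x = 1.
Proof.
move=> frees; pose d := \dim {:V}; pose e := vbasis {:V}.
pose M : 'M[R]_(size s, d) := \matrix_(i, k) s`_i e`_k.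
have rfM : row_free M.
  apply: inj_row_free => u uM.
  have /freeP : free (in_tuple s) by [].
  move=> /(_ (u 0)) fs; apply/rowP => i; rewrite [RHS]mxE; apply: fs.
  apply/lfunP => x; rewrite (coord_vbasis (memvf x)) !linear_sum; apply: eq_bigr => k _.
  rewrite !linearZ /=; congr (_ *: _); rewrite sum_lfunE lfunE /=.
  transitivity ((u *m M) 0 k); last by rewrite uM mxE.
  by rewrite mxE; apply: eq_bigr => j _; rewrite lfunE /= mxE.
pose c := pinvmx M *m (const_mx 1 : 'cV[R]_(size s)).
exists (\sum_k c k 0 *: e`_k) => f fs.
pose i : 'I_(size s) := Ordinal (etrans (index_mem f s) fs).
have fE : f = s`_i by rewrite nth_index.
transitivity ((M *m c) i 0); last by rewrite mulmxA mulmxVp // mul1mx mxE.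
rewrite mxE linear_sum; apply: eq_bigr => k _.
by rewrite linearZ /= [M i k]mxE -fE mulrC.
Qed.
End perturbation.

Section regular.
Variables (R : realType) (n : nat) (a : {vspace 'M[R]_n}).
Local Notation dual := 'Hom(subvs_of a, R^o).
Variables (lam : 'I_n -> dual).

Let diffs := [seq lam ij.1 - lam ij.2 | ij <- enum {: 'I_n * 'I_n} & lam ij.1 != lam ij.2].

Let regularP H : regular lam H <-> forall f, f \in diffs -> f H != 0.
Proof.
split=> [regH f /mapP[[i j]]|dH i j Hij].
  rewrite mem_filter /= => /andP[lij _] ->; rewrite lfunE /= lfunE /= subr_eq0.
  by apply: contra lij => /eqP /regH ->.
apply/eqP; apply: contraT => lij; have : lam i - lam j \in diffs.
  by apply/mapP; exists (i, j) => //; rewrite mem_filter lij mem_enum.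
by move=> /dH; rewrite lfunE /= lfunE /= Hij subrr eqxx.
Qed.

Lemma regular_exists : exists H, regular lam H.
Proof.
have [|H HP] := @exists_nonvanishing R (subvs_of a) diffs.
  by move=> f /mapP[[i j]]; rewrite mem_filter /= => /andP[lij _] ->; rewrite subr_eq0.
by exists H; apply/regularP.
Qed.

Lemma regular_near H0 H1 : regular lam H1 ->
  \forall t \near 0^'+, regular lam (H0 + t *: H1).
Proof.
move=> /regularP reg1.
suff : \forall t \near 0^'+, forall f, f \in diffs -> f (H0 + t *: H1) != 0.
  by apply: filterS => t tP; apply/regularP.
apply: near_seq => f /reg1 f1; under eq_near do rewrite homD_eval.
exact: (near_affine_neq0 (b := f H0) (c := f H1) (introT orP (or_intror f1))).
Qed.

Lemma regular_dominant_exists (Pi : seq dual) : free Pi ->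
  exists2 H, regular lam H & forall s, s \in Pi -> 0 < s H.
Proof.
move=> /free_dual_ones[H0 H0P]; have [H1 reg1] := regular_exists.
have domN : \forall t \near 0^'+, forall s, s \in Pi -> 0 < s (H0 + t *: H1).
  apply: near_seq => s /H0P s0; under eq_near do rewrite homD_eval s0.
  exact: near_affine_gt0.
have /filter_ex[t [regt domt]] : \forall t \near 0^'+,
    regular lam (H0 + t *: H1) /\ forall s, s \in Pi -> 0 < s (H0 + t *: H1).
  by apply: filterI => //; exact: regular_near.
by exists (H0 + t *: H1).
Qed.
End regular.

(** * Maxima on orbits of K *)

Section compact_mx.
Variables (R : realType) (n : nat).

Lemma mx_bounded_closed_compact (A : set 'M[R]_n) (c : R) : closed A ->
  (forall x, A x -> forall i j, `|x i j| <= c) -> compact A.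
Proof.
move=> clA Ac; pose B := [set v : 'rV[R]_(n * n) | A (vec_mx v)].
have vec_cont : continuous (vec_mx : 'rV[R]_(n * n) -> 'M[R]_n).
  move=> v; apply/(@cvg_mxP _ _ (nbhs v) _) => i j; rewrite mxE.
  under eq_fun do rewrite mxE.
  exact: coord_continuous.
have -> : A = vec_mx @` B.
  apply/seteqP; split=> [x Ax|_ [v Bv <-]] //.
  by exists (mxvec x); rewrite /B /= mxvecK.
apply: continuous_compact; first exact: continuous_subspaceT.
apply: bounded_closed_compact; last by apply: closed_comp => // v _; exact: vec_cont.
exists `|c|; split; first exact: num_real.
move=> M cM v /= Bv; apply: (le_trans _ (ltW cM)).
apply: mx_norm_le => // i k; rewrite ord1; case/mxvec_indexP: k => {}i j.
have := Ac _ Bv i j; rewrite mxE => /le_trans; apply; exact: ler_norm.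
Qed.

Lemma continuous_gram : continuous (fun x : 'M[R]_n => x^T *m x).
Proof.
move=> x; apply: (cvg_mulmx (F := nbhs x)); last exact: cvg_id.
by apply: (cvg_trmx (F := nbhs x)); exact: cvg_id.
Qed.

Lemma continuous_orbit_trace (A B : 'M[R]_n) :
  continuous (fun x : 'M[R]_n => \tr (x *m A *m x^T *m B)).
Proof.
move=> x; apply: (cvg_mxtrace (F := nbhs x)).
apply: (cvg_mulmx (F := nbhs x)); last exact: cvg_cst.
apply: (cvg_mulmx (F := nbhs x)).
  by apply: (cvg_mulmx (F := nbhs x)); [exact: cvg_id|exact: cvg_cst].
by apply: (cvg_trmx (F := nbhs x)); exact: cvg_id.
Qed.

Lemma compact_orthogonal_part (G : set 'M[R]_n) : is_subgroup_SL G -> closed G ->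
  compact (orthogonal_part G).
Proof.
move=> subG clG.
have -> : orthogonal_part G = G `&` [set x | x^T *m x = 1%:M].
  apply/seteqP; split=> x [Gx]; first by case.
  by move=> xx; split=> //; split=> //; case: subG => _ _ _; apply.
apply: (@mx_bounded_closed_compact _ 1).
  apply: closedI => //.
  apply: (@closed_comp _ _ (fun x : 'M[R]_n => x^T *m x) [set 1%:M]).
    by move=> x _; exact: continuous_gram.
  by apply: accessible_closed_set1; exact: hausdorff_accessible (@norm_hausdorff _ _).
move=> x [_ /= xx] i j.
have /(congr1 (fun M : 'M[R]_n => M j j)) := xx; rewrite !mxE eqxx => xj.
have : x i j ^+ 2 <= 1.
  rewrite -[leRHS]xj (bigD1 i) //= mxE -expr2 lerDl sumr_ge0 // => k _.
  by rewrite mxE -expr2 sqr_ge0.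
by rewrite -real_normK ?num_real // expr_le1.
Qed.
End compact_mx.

Section trace_form.
Variables (R : realType) (n : nat).
Implicit Types A B X Y S : 'M[R]_n.

Lemma mxtraceN A : \tr (- A) = - \tr A.
Proof. exact: raddfN. Qed.

Lemma mxtraceB A B : \tr (A - B) = \tr A - \tr B.
Proof. exact: raddfB. Qed.

Lemma trace_gram_gt0 S : S != 0 -> 0 < \tr (S^T *m S).
Proof.
move=> S0.
have trE : \tr (S^T *m S) = \sum_i \sum_j S j i ^+ 2.
  by apply: eq_bigr => i _; rewrite mxE; apply: eq_bigr => j _; rewrite mxE expr2.
rewrite trE lt_def sumr_ge0 ?andbT; last by move=> i _; apply: sumr_ge0 => j _; rewrite sqr_ge0.
apply: contraNneq S0 => H; apply/eqP/matrixP => j i; rewrite mxE.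
have H1 : \sum_j S j i ^+ 2 = 0.
  move/eqP: H; rewrite psumr_eq0; last by move=> k _; apply: sumr_ge0 => l _; rewrite sqr_ge0.
  by move=> /allP /(_ i (mem_index_enum _)) /eqP.
move/eqP: H1; rewrite psumr_eq0; last by move=> l _; rewrite sqr_ge0.
by move=> /allP /(_ j (mem_index_enum _)); rewrite sqrf_eq0 => /eqP.
Qed.

Lemma bracketN X Y : bracket (- X) Y = - bracket X Y.
Proof. by rewrite -scaleN1r bracketZl scaleN1r. Qed.

(** This identity gives the second-order condition at a maximum from first-order
expansions: if F is the inverse of E, its right-hand side is the second
difference of the function k |-> tr(k A k^-1 H) at 1 in the direction E. *)
Lemma trace_bracket_inverse (E F A H : 'M[R]_n) : E *m F = 1%:M -> F *m E = 1%:M ->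
  \tr (bracket E A *m bracket F H) =
    \tr (E *m A *m F *m H) + \tr (F *m A *m E *m H) - (\tr (A *m H) + \tr (A *m H)).
Proof.
move=> EF FE.
have -> : bracket E A *m bracket F H = E *m A *m F *m H - E *m A *m H *m F -
    (A *m H - A *m E *m H *m F).
  by rewrite /bracket mulmxBl !mulmxBr !mulmxA -[A *m E *m F]mulmxA EF mulmx1.
rewrite !mxtraceB [\tr (E *m A *m H *m F)]mxtrace_mulC [\tr (A *m E *m H *m F)]mxtrace_mulC.
rewrite !mulmxA FE mul1mx; move: (\tr _) (\tr (F *m _ *m _ *m _)) (\tr (A *m H)) => x y z.
by ring.
Qed.

Section critical.
Variables (A H Y : 'M[R]_n).
Hypothesis maxA : forall t : R,
  \tr (expmx (t *: Y) *m A *m expmx (- (t *: Y)) *m H) <= \tr (A *m H).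

Let e (m : nat) : R := m.+1%:R^-1.
Let e_gt0 m : 0 < e m. Proof. by rewrite invr_gt0 ltr0n. Qed.
Let e_neq0 m : e m != 0. Proof. by rewrite gt_eqF. Qed.
Let e_cvg : e @ \oo --> (0 : R). Proof. exact: cvg_harmonic. Qed.
Let q (Z : 'M[R]_n) m := (e m)^-1 *: (expmx (e m *: Z) - 1%:M).
Let q_cvg Z : q Z @ \oo --> Z. Proof. exact: expmx_quotient. Qed.
Let expE Z m : expmx (e m *: Z) = 1%:M + e m *: q Z m.
Proof. by rewrite /q scalerKV // addrC subrK. Qed.
Let bracket_cvg (f : nat -> 'M[R]_n) X B : f @ \oo --> X ->
  bracket (f m) B @[m --> \oo] --> bracket X B.
Proof. by move=> fX; apply: cvgB; apply: cvg_mulmx => //; exact: cvg_cst. Qed.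
Let bracket_exp Z m B : bracket (expmx (e m *: Z)) B = e m *: bracket (q Z m) B.
Proof.
rewrite expE /bracket mulmxDl mulmxDr mul1mx mulmx1 -scalemxAl -scalemxAr.
by rewrite scalerBr opprD addrACA subrr add0r.
Qed.

Lemma critical_first : \tr (bracket Y A *m H) <= 0.
Proof.
have lim : \tr (bracket (q Y m) A *m expmx (e m *: - Y) *m H) @[m --> \oo] -->
    \tr (bracket Y A *m 1%:M *m H).
  apply: cvg_mxtrace; apply: cvg_mulmx; last exact: cvg_cst.
  by apply: cvg_mulmx; [exact: bracket_cvg|exact: expmx_cvg1].
rewrite mulmx1 in lim; apply: (cvgr_to_le lim); apply: nearW => m.
rewrite -(pmulr_rle0 _ (e_gt0 m)) -mxtraceZ !scalemxAl -bracket_exp scalerN.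
have := maxA (e m); rewrite /bracket !mulmxBl mxtraceB.
by rewrite -[A *m _ *m _]mulmxA expmxKN mulmx1 subr_le0.
Qed.

Lemma critical_second : 0 <= \tr (bracket Y A *m bracket Y H).
Proof.
have lim : \tr (bracket (q Y m) A *m bracket (q (- Y) m) H) @[m --> \oo] -->
    \tr (bracket Y A *m bracket (- Y) H).
  by apply: cvg_mxtrace; apply: cvg_mulmx; exact: bracket_cvg.
rewrite bracketN mulmxN in lim; rewrite -oppr_le0 -mxtraceN.
apply: (cvgr_to_le lim); apply: nearW => m.
have scaleE : e m * (e m * \tr (bracket (q Y m) A *m bracket (q (- Y) m) H)) =
    \tr (bracket (expmx (e m *: Y)) A *m bracket (expmx (- (e m *: Y))) H).
  rewrite -[in RHS]scalerN !bracket_exp.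
  move: (bracket _ A) (bracket _ H) (e m) => B D d.
  by rewrite -scalemxAl -scalemxAr !mxtraceZ.
rewrite -(pmulr_rle0 _ (e_gt0 m)) -(pmulr_rle0 _ (e_gt0 m)) scaleE.
rewrite (trace_bracket_inverse A H (expmxKN (e m *: Y)) (expmxNK (e m *: Y))).
have max1 := maxA (e m); have := maxA (- e m); rewrite scaleNr opprK => max2.
by rewrite subr_le0; exact: lerD.
Qed.
End critical.
End trace_form.

(** * The Weyl group and the chambers *)

Section weyl.
Variables (R : realType) (n : nat) (G : set 'M[R]_n).
Hypotheses (subG : is_subgroup_SL G) (closedG : closed G).
Hypothesis cartan : G = [set k *m expmx x | k in orthogonal_part G & x in symmetric_part G].
Implicit Types A B X Y S k : 'M[R]_n.
Local Notation K := (orthogonal_part G).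
Local Notation p := (symmetric_part G).

Lemma orthogonal_partP k : K k -> [/\ G k, k^T *m k = 1%:M, k *m k^T = 1%:M & invmx k = k^T].
Proof.
move=> [Gk [kk _]]; have kk' := mulmx1C kk; split=> //.
have [ku _] := mulmx1_unit kk'.
by rewrite -[LHS]mulmx1 -kk' mulKmx.
Qed.

Lemma orthogonal_partI k : G k -> k^T *m k = 1%:M -> K k.
Proof. by case: subG => _ _ _ Gdet Gk kk; split=> //; split=> //; exact: Gdet. Qed.

Lemma orthogonal_part_tr k : K k -> K k^T.
Proof.
move=> /[dup] Kk /orthogonal_partP[Gk kk kk' kV].
apply: orthogonal_partI; last by rewrite trmxK.
by rewrite -kV; case: subG => _ _ GV _; exact: GV.
Qed.

Lemma orthogonal_partM k h : K k -> K h -> K (k *m h).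
Proof.
move=> /orthogonal_partP[Gk kk _ _] /orthogonal_partP[Gh hh _ _].
apply: orthogonal_partI; first by case: subG => _ GM _ _; exact: GM.
by rewrite trmx_mul -mulmxA [k^T *m _]mulmxA kk mul1mx.
Qed.

Lemma orthogonal_part1 : K 1%:M.
Proof. by case: subG => G1 _ _ _; apply: orthogonal_partI; rewrite // trmx1 mulmx1. Qed.

(** The polar decomposition makes G stable under transposition. *)
Lemma subgroup_tr x : G x -> G x^T.
Proof.
case: subG => _ GM _ _; rewrite {1}cartan => -[k Kk [X [gX [Xs _]] <-]].
rewrite trmx_mul expmx_tr Xs; apply: GM; first exact: lie_algebra_exp.
by have [] := orthogonal_partP (orthogonal_part_tr Kk).
Qed.

Lemma lie_algebra_tr X : lie_algebra G X -> lie_algebra G X^T.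
Proof.
by move=> gX t; rewrite -linearZ /= -expmx_tr; apply: subgroup_tr; exact: gX.
Qed.

Lemma expmx_skew_orthogonal X : lie_algebra G X -> X^T = - X -> K (expmx X).
Proof.
move=> gX Xs; apply: orthogonal_partI; first exact: lie_algebra_exp.
by rewrite expmx_tr Xs expmxNK.
Qed.

Lemma symmetric_partD X Y : p X -> p Y -> p (X + Y).
Proof.
move=> [gX [Xs X0]] [gY [Ys Y0]]; split; first exact: lie_algebraD.
by split; rewrite ?linearD /= ?Xs ?Ys // X0 Y0 addr0.
Qed.

Lemma symmetric_partZ (c : R) X : p X -> p (c *: X).
Proof.
move=> [gX [Xs X0]]; split; first exact: lie_algebraZ.
by split; rewrite linearZ /= ?Xs // X0 mulr0.
Qed.

Lemma symmetric_partB X Y : p X -> p Y -> p (X - Y).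
Proof.
move=> pX pY; rewrite -[- Y]scaleN1r; apply: symmetric_partD => //.
exact: symmetric_partZ.
Qed.

Lemma symmetric_part_Ad k X : K k -> p X -> p (k *m X *m k^T).
Proof.
move=> /orthogonal_partP[Gk kk kk' kV] [gX [Xs X0]]; split.
  by rewrite -kV; exact: lie_algebra_Ad.
split; first by rewrite !trmx_mul trmxK Xs mulmxA.
by rewrite mxtrace_mulC mulmxA kk mul1mx.
Qed.

Lemma bracket_skew_sym Y X : lie_algebra G Y -> Y^T = - Y -> p X -> p (bracket Y X).
Proof.
move=> gY Ys [gX [Xs _]]; split; first exact: lie_algebra_bracket.
split; last by rewrite /bracket mxtraceB [\tr (X *m Y)]mxtrace_mulC subrr.
by rewrite /bracket linearB /= !trmx_mul Xs Ys mulmxN mulNmx opprK addrC.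
Qed.

Lemma bracket_sym_sym X Y : p X -> p Y -> (bracket X Y)^T = - bracket X Y.
Proof.
by move=> [_ [Xs _]] [_ [Ys _]]; rewrite /bracket linearB /= !trmx_mul Xs Ys opprB.
Qed.

Lemma bracket_eq0 X Y : bracket X Y = 0 <-> X *m Y = Y *m X.
Proof.
split=> [/eqP|XY]; last by rewrite /bracket XY subrr.
by rewrite subr_eq0 => /eqP.
Qed.

Variable (a : {vspace 'M[R]_n}).
Hypothesis maxa : maximal_abelian_in p a.
Local Notation dual := 'Hom(subvs_of a, R^o).

Lemma maximal_abelian_sub X : X \in a -> p X.
Proof. by case: maxa => ap _ _; exact: ap. Qed.

Lemma maximal_abelian_comm X Y : X \in a -> Y \in a -> X *m Y = Y *m X.
Proof. by case: maxa => _ aab _ Xa Ya; apply/bracket_eq0; exact: aab. Qed.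

Lemma maximal_abelian_sym X : X \in a -> X^T = X.
Proof. by move=> /maximal_abelian_sub[_ []]. Qed.

(** The span of a and X is an abelian subspace of p. *)
Lemma maximal_abelian_self_centralizing X : p X ->
  (forall H, H \in a -> X *m H = H *m X) -> X \in a.
Proof.
move=> pX aX; case: maxa => ap aab amax.
suff <- : (a + <[X]>)%VS = a by rewrite (subvP (addvSr _ _)) // memv_line.
apply: amax; last exact: addvSl.
  move=> _ /memv_addP[H Ha [_ /vlineP[c ->] ->]].
  by apply: symmetric_partD; [exact: ap|exact: symmetric_partZ].
move=> _ _ /memv_addP[H Ha [_ /vlineP[c ->] ->]] /memv_addP[H' Ha' [_ /vlineP[c' ->] ->]].
apply/bracket_eq0; rewrite !mulmxDl !mulmxDr -!scalemxAl -!scalemxAr.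
rewrite (maximal_abelian_comm Ha Ha') (aX _ Ha) (aX _ Ha') !scalerA [c * c']mulrC.
by rewrite addrACA.
Qed.

Variables (Q : 'M[Cplx R]_n) (lam : 'I_n -> dual).
Hypothesis QP : codiagonal Q lam.

Lemma regular_centralizer (H : subvs_of a) X : regular lam H -> p X ->
  X *m vsval H = vsval H *m X -> X \in a.
Proof.
move=> regH pX XH; apply: maximal_abelian_self_centralizing => // B Ba.
by rewrite -(vsprojK Ba); exact: (regular_comm QP regH XH).
Qed.

(** An injective linear map sending the finite-dimensional a into itself is onto. *)
Lemma conj_stable_onto k : k^T *m k = 1%:M -> (forall B, B \in a -> k^T *m B *m k \in a) ->
  forall B, B \in a -> k *m B *m k^T \in a.
Proof.
move=> kk sub B Ba; have kk' := mulmx1C kk.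
have [phi phiE] : exists phi : 'Hom('M[R]_n, 'M[R]_n), forall X, phi X = k^T *m X *m k.
  by apply: linear_hom => c X Y; rewrite mulmxDr mulmxDl -scalemxAr -scalemxAl.
have phia : (phi @: a <= a)%VS.
  by apply/subvP => _ /memv_imgP[X Xa ->]; rewrite phiE; exact: sub.
have kphi : lker phi == 0%VS.
  apply/lker0P => X Y; rewrite !phiE => /(congr1 (fun Z => k *m Z *m k^T)).
  by rewrite !mulmxA kk' !mul1mx -!mulmxA kk' !mulmx1.
have : (phi @: a == a)%VS.
  have dimE : \dim (phi @: a) = \dim a.
    by apply: limg_dim_eq; rewrite (eqP kphi) capv0.
  by rewrite eqEdim phia dimE leqnn.
move=> /eqP phiaE; rewrite -phiaE in Ba; case/memv_imgP: Ba => X Xa ->.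
by rewrite phiE !mulmxA kk' mul1mx -mulmxA kk' mulmx1.
Qed.

Lemma normalizer_of_stable k : K k -> (forall B, B \in a -> k^T *m B *m k \in a) ->
  normalizer K a k.
Proof.
move=> Kk sub; have [Gk kk kk' kV] := orthogonal_partP Kk; split=> //; rewrite kV.
apply/seteqP; split=> [_ [B Ba <-]|B Ba] /=; first exact: conj_stable_onto.
exists (k^T *m B *m k); first exact: sub.
by rewrite !mulmxA kk' mul1mx -mulmxA kk' mulmx1.
Qed.

Lemma normalizerP k : normalizer K a k -> [/\ K k, normalizer K a k^T,
  forall B, B \in a -> k *m B *m k^T \in a & forall B, B \in a -> k^T *m B *m k \in a].
Proof.
move=> [Kk]; have [Gk kk kk' kV] := orthogonal_partP Kk; rewrite kV => aE.
have sub B : B \in a -> k *m B *m k^T \in a.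
  move=> Ba; have : [set k *m X *m k^T | X in [set` a]] (k *m B *m k^T) by exists B.
  by rewrite aE.
have sub' B : B \in a -> k^T *m B *m k \in a.
  have := @conj_stable_onto k^T; rewrite trmxK; exact.
split=> //; apply: normalizer_of_stable; first exact: orthogonal_part_tr.
by rewrite trmxK.
Qed.

(** If B is in a, it commutes with Ad(k) H, so Ad(k^-1) B commutes with the regular
element H and is in a again. *)
Lemma normalizer_of_regular k (H : subvs_of a) : K k -> regular lam H ->
  k *m vsval H *m k^T \in a -> normalizer K a k.
Proof.
move=> Kk regH Aa; have [Gk kk kk' kV] := orthogonal_partP Kk.
apply: normalizer_of_stable => // B Ba; apply: (regular_centralizer regH).
  rewrite -{2}[k]trmxK; apply: symmetric_part_Ad; first exact: orthogonal_part_tr.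
  exact: maximal_abelian_sub.
have := maximal_abelian_comm Ba Aa => /(congr1 (fun Z => k^T *m Z *m k)).
by rewrite !mulmxA kk mul1mx -!mulmxA kk mulmx1.
Qed.

(** If v is a weight vector, so is k v; the weight l' is l composed with the inverse
of Ad(k). *)
Lemma weyl_weight k (l : dual) : normalizer K a k -> is_weight l ->
  exists l' : dual, is_weight l' /\
    forall B B' : subvs_of a, vsval B' = k *m vsval B *m k^T -> l' B' = l B.
Proof.
move=> /normalizerP[Kk _ sub sub'] [v v0 vl].
have [Gk kk kk' kV] := orthogonal_partP Kk.
have [l' l'E] : exists l' : dual, forall B : subvs_of a, l' B = l (vsproj a (k^T *m vsval B *m k)).
  apply: linear_hom => c X Y.
  have -> : vsval (c *: X + Y) = c *: vsval X + vsval Y by exact: linearP.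
  by rewrite mulmxDr mulmxDl -scalemxAr -scalemxAl linearP linearP.
exists l'; split; last first.
  move=> B B' B'E; rewrite l'E B'E !mulmxA kk mul1mx -mulmxA kk mulmx1.
  by rewrite vsvalK.
exists (k *m v).
  by apply: contra v0 => /eqP /(congr1 (mulmx k^T)); rewrite mulmxA kk mul1mx mulmx0 => ->.
move=> B; rewrite l'E; have := vl (vsproj a (k^T *m vsval B *m k)).
rewrite vsprojK; last by apply: sub'; exact: subvsP.
move=> /(congr1 (mulmx k)); rewrite !mulmxA kk' mul1mx => ->.
by rewrite scalemxAr.
Qed.

(** For a root vector X take Y = X - X^T and S = X + X^T. The matrix S is not 0: the
bracket of a symmetric matrix with a skew one is symmetric, so X skew would
make s(H) X both symmetric and skew for all H, and s would vanish. *)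
Lemma root_vector_skew (s : dual) : is_root (lie_algebra G) s ->
  exists2 S : 'M[R]_n, 0 < \tr (S *m S) & exists Y, [/\ lie_algebra G Y, Y^T = - Y &
    forall H : subvs_of a, bracket Y (vsval H) = - (s H : R) *: S].
Proof.
move=> [s0 [X [gX X0] sX]].
have Ht (H : subvs_of a) : (vsval H)^T = vsval H by exact: maximal_abelian_sym (subvsP H).
have sXt H : bracket (vsval H) X^T = - (s H *: X^T).
  by rewrite -linearZ -sX /bracket linearB /= !trmx_mul Ht opprB.
exists (X + X^T).
  have {1}<- : (X + X^T)^T = X + X^T by rewrite linearD /= trmxK addrC.
  apply: trace_gram_gt0.
  apply: contra s0 => /eqP XX; apply/eqP/lfunP => H; rewrite lfunE /=.
  have XtE : X^T = - X by apply/eqP; rewrite -addr_eq0 addrC XX.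
  have := sXt H; rewrite XtE /bracket mulmxN mulNmx -opprD -[_ - _]/(bracket _ _) sX.
  move=> /oppr_inj; rewrite scalerN => /eqP; rewrite -subr_eq0 opprK -scalerDl scaler_eq0.
  by rewrite (negPf X0) orbF -mulr2n mulrn_eq0 /= => /eqP.
exists (X - X^T); split.
- by apply: lie_algebraD => //; apply: lie_algebraN; exact: lie_algebra_tr.
- by rewrite linearB /= trmxK opprB.
move=> H; have -> : bracket (X - X^T) (vsval H) = bracket (vsval H) X^T - bracket (vsval H) X.
  rewrite /bracket mulmxBl mulmxBr opprD opprK !opprB.
  by rewrite addrACA addrC; congr (_ + _); rewrite addrC.
by rewrite sXt sX scaleNr scalerDr opprD addrC.
Qed.

(** The Weyl group acts transitively on chambers. Instead of composing reflections,
maximize tr(Ad(k) H H') over k in K: a maximum is critical, which forces k to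
normalize a, and the second derivatives there are <= 0, which forces Ad(k) H
into the closed chamber of H'. *)
Lemma exists_dominant_conj (H H' : subvs_of a) : regular lam H -> regular lam H' ->
  exists2 k, normalizer K a k & exists2 A : subvs_of a, vsval A = k *m vsval H *m k^T &
    forall s : dual, is_root (lie_algebra G) s -> 0 < s H' -> 0 <= s A.
Proof.
move=> regH regH'.
have [] := @compact_EVT_max _ R (fun x : 'M[R]_n => \tr (x *m vsval H *m x^T *m vsval H')) K.
- by exists 1%:M; exact: orthogonal_part1.
- exact: compact_orthogonal_part.
- by apply: continuous_subspaceT; exact: continuous_orbit_trace.
move=> k /set_mem Kk kmax.
have [Gk kk kk' kV] := orthogonal_partP Kk.
pose A := k *m vsval H *m k^T.
have pH := maximal_abelian_sub (subvsP H); have pH' := maximal_abelian_sub (subvsP H').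
have pA : p A by exact: symmetric_part_Ad.
have Amax Y : lie_algebra G Y -> Y^T = - Y -> forall t : R,
    \tr (expmx (t *: Y) *m A *m expmx (- (t *: Y)) *m vsval H') <= \tr (A *m vsval H').
  move=> gY Ys t; have gtY := lie_algebraZ t gY.
  have tYs : (t *: Y)^T = - (t *: Y) by rewrite linearZ /= Ys scalerN.
  have Kh := expmx_skew_orthogonal gtY tYs.
  have := kmax _ (mem_set (orthogonal_partM Kh Kk)).
  by rewrite trmx_mul expmx_tr tYs !mulmxA.
have AH' : A *m vsval H' = vsval H' *m A.
  apply/bracket_eq0; set Y := bracket A (vsval H').
  have gY : lie_algebra G Y by apply: lie_algebra_bracket => //; [case: pA|case: pH'].
  have Ys : Y^T = - Y by exact: bracket_sym_sym.
  have trE : \tr (bracket Y A *m vsval H') = \tr (Y *m Y).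
    transitivity (\tr (Y *m (A *m vsval H' - vsval H' *m A))); last by [].
    move: (Y) (A) (vsval H') => Z B C; rewrite /bracket mulmxBl mulmxBr !mxtraceB -!mulmxA; congr (_ - _).
    by rewrite mxtrace_mulC -mulmxA.
  (* Y is skew, so tr(Y Y) <= 0; moving in the direction -Y shows tr(Y Y) >= 0 *)
  have gNY := lie_algebraN gY; have NYs : (- Y)^T = - - Y by rewrite linearN /= Ys.
  have := critical_first (Amax _ gNY NYs); rewrite bracketN mulNmx mxtraceN trE oppr_le0 => YY0.
  apply/eqP; apply: contraT => /trace_gram_gt0; rewrite Ys mulNmx mxtraceN oppr_gt0.
  by rewrite ltNge YY0.
have Aa : A \in a by exact: (regular_centralizer regH').
exists k; first exact: (normalizer_of_regular Kk regH).
exists (vsproj a A); first by rewrite vsprojK.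
move=> s /root_vector_skew[S S0 [Y [gY Ys YE]]] sH'.
have := critical_second (Amax Y gY Ys).
rewrite -{1}(vsprojK Aa) !YE -scalemxAl -scalemxAr !mxtraceZ !mulNr mulrN opprK mulrA.
by rewrite pmulr_lge0 // pmulr_lge0.
Qed.

Variables (Pi : seq dual) (mu_rho : dual) (x_rho : 'M[R]_n) (c : R).
Hypotheses (basePi : is_base (lie_algebra G) Pi) (hwP : is_highest_weight Pi mu_rho).
Hypothesis x_rhoE : forall H : subvs_of a, c * \tr (x_rho *m vsval H) = mu_rho H.

Lemma weight_le_orbit (H : subvs_of a) : regular lam H ->
  exists2 q, weyl_orbit K a x_rho q &
    forall l : dual, is_weight l -> l H <= c * \tr (q *m vsval H).
Proof.
case: basePi => freePi rootPi _ regH.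
have [H' regH' H'Pi] := regular_dominant_exists lam freePi.
have [k Nk [A AE Adom]] := exists_dominant_conj regH regH'.
have [Kk Nk' sub sub'] := normalizerP Nk; have [Gk kk kk' kV] := orthogonal_partP Kk.
exists (k^T *m x_rho *m k).
  by exists k^T => //; have [_ _ _ ->] := orthogonal_partP (orthogonal_part_tr Kk); rewrite trmxK.
move=> l wl; have [l' [wl' l'E]] := weyl_weight Nk wl.
rewrite -(l'E H A AE); have [d d0 ->] := hwP.2 l' wl'.
have -> : c * \tr (k^T *m x_rho *m k *m vsval H) = mu_rho A.
  by rewrite -x_rhoE AE -!mulmxA mxtrace_mulC !mulmxA.
rewrite lfunE /= lfunE /= lerBlDr lerDl sum_lfunE big_seq sumr_ge0 // => s sPi.
by rewrite lfunE /= mulr_ge0 ?d0 // Adom //; [exact: rootPi|exact: H'Pi].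
Qed.

Lemma weyl_orbit_weight q : x_rho \in a -> weyl_orbit K a x_rho q ->
  q \in a /\ exists2 l : dual, is_weight l &
    forall H : subvs_of a, c * \tr (q *m vsval H) = l H.
Proof.
move=> xa [k /[dup] Nk /normalizerP[Kk _ sub sub'] <-].
have [Gk kk kk' kV] := orthogonal_partP Kk; rewrite kV.
split; first exact: sub.
have [l [wl lE]] := weyl_weight Nk hwP.1; exists l => // H.
have subH := sub' _ (subvsP H).
rewrite (lE (vsproj a (k^T *m vsval H *m k)) H); last first.
  by rewrite vsprojK // !mulmxA kk' mul1mx -mulmxA kk' mulmx1.
rewrite -x_rhoE vsprojK //; congr (_ * _).
by rewrite -!mulmxA mxtrace_mulC !mulmxA.
Qed.
End weyl.

(** * Convex hulls of finite sets *)

Section convex.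
Variables (R : realType) (n : nat).
Implicit Types (S : set 'M[R]_n) (x y : 'M[R]_n).

Lemma convex_setI01 S x y (t : R) : convex_set S -> S x -> S y -> 0 <= t <= 1 ->
  S (t *: x + (1 - t) *: y).
Proof.
move=> cS Sx Sy /andP[t0 t1].
by have /set_mem := cS x y (Itv01 t0 t1) (mem_set Sx) (mem_set Sy).
Qed.

(** A convex combination with the missing mass put on x. This form needs no
renormalization of partial sums, so the induction never divides by 0. *)
Lemma convex_set_partial_sum S (I : Type) (r : seq I) (t : I -> R) (q : I -> 'M[R]_n) x :
  convex_set S -> (forall i, S (q i)) -> (forall i, 0 <= t i) -> S x ->
  \sum_(i <- r) t i <= 1 ->
  S (\sum_(i <- r) t i *: q i + (1 - \sum_(i <- r) t i) *: x).
Proof.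
move=> cS Sq t0; elim: r x => [|i r IH] x Sx; rewrite ?big_nil ?big_cons.
  by rewrite add0r subr0 scale1r.
set T := \sum_(j <- r) t j => T1; set s := 1 - T.
have s_ge : t i <= s by rewrite lerBrDr.
have s0 : 0 <= s by exact: le_trans s_ge.
(* x' absorbs the mass t i of q i; if s = 0 then t i = 0, and x' = x as t i / 0 = 0 *)
pose x' := (t i / s) *: q i + (1 - t i / s) *: x.
have Sx' : S x'.
  apply: convex_setI01 => //; rewrite divr_ge0 //=.
  have [->|sn0] := eqVneq s 0; first by rewrite invr0 mulr0.
  by rewrite ler_pdivrMr ?mul1r // lt_def sn0.
have sx' : s *: x' = t i *: q i + (s - t i) *: x.
  rewrite scalerDr !scalerA; have [sE|sn0] := eqVneq s 0.
    have -> : t i = 0 by apply/eqP; rewrite eq_le t0 andbT -sE.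
    by rewrite sE !mul0r subr0 !scale0r.
  by congr (_ *: _ + _ *: _); field.
have -> : 1 - (t i + T) = s - t i by rewrite /s; ring.
rewrite -addrA [X in _ + X]addrC addrA -sx' addrC.
by apply: IH => //; rewrite (le_trans _ T1) // lerDr.
Qed.

Lemma convex_set_sum S (I : Type) (r : seq I) (t : I -> R) (q : I -> 'M[R]_n) :
  convex_set S -> (forall i, S (q i)) -> (forall i, 0 <= t i) ->
  \sum_(i <- r) t i = 1 -> S (\sum_(i <- r) t i *: q i).
Proof.
case: r => [|i r] cS Sq t0 t1; first by move: t1; rewrite big_nil => /eqP; rewrite eq_sym oner_eq0.
have := @convex_set_partial_sum S I (i :: r) t q (q i) cS Sq t0 (Sq i).
by rewrite t1 subrr scale0r addr0 => /(_ (lexx _)).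
Qed.

Lemma convex_hull_sub S : S `<=` convex_hull S.
Proof. exact: sub_smallest. Qed.

Lemma convex_hull_convex S : convex_set (convex_hull S).
Proof.
move=> x y l /set_mem hx /set_mem hy; apply/mem_set => C [cC SC].
by apply/set_mem; apply: (cC); apply/mem_set; [exact: (hx C (conj cC SC))|exact: (hy C (conj cC SC))].
Qed.

Lemma convex_hull_min S (C : set 'M[R]_n) : convex_set C -> S `<=` C -> convex_hull S `<=` C.
Proof. by move=> cC SC x; apply. Qed.

Lemma convex_halfspace (H : 'M[R]_n) (c : R) : convex_set [set x | \tr (x *m H) <= c].
Proof.
move=> x y l /set_mem /= xc /set_mem /= yc; apply/mem_set => /=.
have [l0 l1] : 0 <= l%:num /\ l%:num <= 1 by split; [exact: ge0|exact: le1].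
rewrite [X in X *m H](_ : _ = l%:num *: x + (1 - l%:num) *: y) //.
rewrite mulmxDl -!scalemxAl mxtraceD !mxtraceZ.
have l1' : 0 <= 1 - l%:num by rewrite subr_ge0.
have := ler_wpM2l l0 xc; have := ler_wpM2l l1' yc; lra.
Qed.

Lemma convex_vspace (a : {vspace 'M[R]_n}) : convex_set [set` a].
Proof.
move=> x y l /set_mem /= xa /set_mem /= ya; apply/mem_set => /=.
by apply: rpredD; apply: rpredZ.
Qed.
End convex.

Section separation.
Variables (R : realType) (n m : nat) (q : 'I_m -> 'M[R]_n) (y : 'M[R]_n).
Hypothesis m_gt0 : (0 < m)%N.

Let inner (A B : 'M[R]_n) := \tr (A^T *m B).

Let simplex : set 'rV[R]_m := [set t | (forall i, 0 <= t 0 i) /\ \sum_i t 0 i = 1].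

Let comb (t : 'rV[R]_m) := \sum_i t 0 i *: q i.

Lemma simplex_compact : compact simplex.
Proof.
apply: bounded_closed_compact.
  exists 1; split; first exact: num_real.
  move=> M M1 t [t0 t1]; apply: (le_trans _ (ltW M1)).
  apply: mx_norm_le => // i j; rewrite ord1 ger0_norm //.
  by rewrite -t1 (bigD1 j) //= lerDl sumr_ge0.
have -> : simplex = (\bigcap_i [set t : 'rV[R]_m | 0 <= t 0 i]) `&`
    [set t : 'rV[R]_m | \sum_i t 0 i = 1].
  apply/seteqP; split=> t [t0 t1]; split=> // i; [move=> _; exact: t0|exact: t0].
apply: closedI.
  apply: closed_bigI => i _.
  apply: (@closed_comp _ _ (fun t : 'rV[R]_m => t 0 i) [set x | 0 <= x]).
    by move=> t _; exact: coord_continuous.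
  exact: closed_ge.
apply: (@closed_comp _ _ (fun t : 'rV[R]_m => \sum_i t 0 i) [set x | x = 1]).
  by move=> t _; apply: (cvg_sum (F := nbhs t)) => i _; exact: coord_continuous.
exact: closed_eq.
Qed.

(** If the point of the hull nearest to y is not y itself, subtracting it from y
gives the normal of a strictly separating hyperplane. *)
Lemma separation : (exists2 t, simplex t & y = comb t) \/
  exists2 t, simplex t & forall i, inner (y - comb t) (q i) < inner (y - comb t) y.
Proof.
have simplex0 : simplex !=set0.
  exists (delta_mx 0 (Ordinal m_gt0)); split=> [i|]; first by rewrite mxE ler0n.
  rewrite (bigD1 (Ordinal m_gt0)) //= mxE !eqxx big1 ?addr0 // => i i0.
  by rewrite mxE (negPf i0) ?andbF.
have comb_cont : continuous comb.
  move=> t; apply: (cvg_sum (F := nbhs t)) => i _.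
  by apply: (cvgZ (F := nbhs t)); [exact: coord_continuous|exact: cvg_cst].
have [] := @compact_EVT_min _ R (fun t => inner (y - comb t) (y - comb t)) simplex simplex0 simplex_compact.
  apply: continuous_subspaceT => t; apply: (cvg_mxtrace (F := nbhs t)).
  have ct : (y - comb u) @[u --> t] --> y - comb t.
    by apply: (cvgB (F := nbhs t)); [exact: cvg_cst|exact: comb_cont].
  by apply: (cvg_mulmx (F := nbhs t)) => //; apply: (cvg_trmx (F := nbhs t)).
move=> t /set_mem St tmin; set z := y - comb t in tmin.
have [z0|zn0] := eqVneq z 0.
  by left; exists t => //; apply/eqP; rewrite -subr_eq0 -/z z0.
right; exists t => // i; rewrite -/z.
have innerC A B : inner A B = inner B A.
  by rewrite /inner -mxtrace_tr trmx_mul trmxK.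
have innerDr A B D : inner A (B + D) = inner A B + inner A D.
  by rewrite /inner mulmxDr mxtraceD.
have innerZr A B (d : R) : inner A (d *: B) = d * inner A B.
  by rewrite /inner -scalemxAr mxtraceZ.
have innerSq A B (d : R) : inner (A + d *: B) (A + d *: B) =
    inner A A + 2 * d * inner A B + d ^+ 2 * inner B B.
  rewrite innerDr innerZr [inner (A + _) A]innerC [inner (A + _) B]innerC !innerDr !innerZr.
  by rewrite [inner B A]innerC; ring.
pose w := q i - comb t.
have zw (e : R) : 0 < e -> e <= 1 -> 2 * inner z w <= e * inner w w.
  move=> e0 e1; pose t' := (1 - e) *: t + e *: delta_mx 0 i.
  have t'E j : t' 0 j = (1 - e) * t 0 j + e * (j == i)%:R by rewrite !mxE.
  have St' : simplex t'.
    case: St => t0 t1; split=> [j|].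
      by rewrite t'E addr_ge0 ?mulr_ge0 ?ler0n ?subr_ge0 // ltW.
    under eq_bigr do rewrite t'E.
    rewrite big_split /= -!mulr_sumr t1 mulr1 (bigD1 i) //= eqxx big1 ?addr0 ?mulr1 ?subrK //.
    by move=> j /negPf ->.
  have ct' : y - comb t' = z + (- e) *: w.
    have -> : comb t' = (1 - e) *: comb t + e *: q i.
      rewrite /comb; under eq_bigr do rewrite t'E scalerDl -!scalerA.
      rewrite big_split /= -!scaler_sumr; congr (_ + _ *: _).
      rewrite (bigD1 i) //= eqxx scale1r big1 ?addr0 // => j /negPf ->.
      by rewrite scale0r.
    rewrite /z /w scaleNr scalerBr scalerBl scale1r !opprB opprD opprB.
    by apply/matrixP => k l; rewrite !mxE; ring.
  have := tmin _ (mem_set St'); rewrite ct' innerSq => H.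
  have : 0 <= e * (e * inner w w - 2 * inner z w) by lra.
  by rewrite pmulr_rge0 // subr_ge0.
have zw0 : inner z w <= 0.
  rewrite leNgt; apply/negP => zwp.
  have ww0 : 0 <= inner w w.
    by have := zw 1 ltr01 (lexx _); rewrite mul1r; lra.
  (* this e is in ]0, 1] and e <w, w> < <z, w> *)
  pose e := inner z w / (inner z w + inner w w).
  have d0 : 0 < inner z w + inner w w by lra.
  have e0 : 0 < e by rewrite divr_gt0.
  have e1 : e <= 1 by rewrite ler_pdivrMr // mul1r lerDl.
  have := zw e e0 e1; rewrite /e mulrAC ler_pdivlMr // mulrDr.
  nra.
have zz : 0 < inner z z by exact: trace_gram_gt0.
have -> : inner z y = inner z z + inner z (comb t) by rewrite -innerDr subrK.
have -> : inner z (q i) = inner z w + inner z (comb t) by rewrite -innerDr subrK.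
by rewrite ltrD2r; exact: le_lt_trans zw0 zz.
Qed.
End separation.

(** * Compact orbits in projective space *)

Section continuity.
Variables (R : realType).
Local Notation C := (Cplx R).

Lemma continuous_ReC : continuous (@complex.Re R : C -> R).
Proof.
move=> c; apply/(@cvgrPdist_lt _ _ _ (nbhs c) _) => e e0.
apply/nbhs_ballP; exists (toC e); first by rewrite /= ltcR.
move=> z /=; rewrite /ball /= => cz; rewrite -ltcR.
by apply: le_lt_trans cz; rewrite -raddfB; exact: normc_ge_Re.
Qed.

Lemma continuous_ImC : continuous (@complex.Im R : C -> R).
Proof.
move=> c; apply/(@cvgrPdist_lt _ _ _ (nbhs c) _) => e e0.
apply/nbhs_ballP; exists (toC e); first by rewrite /= ltcR.
move=> z /=; rewrite /ball /= => cz; rewrite -ltcR.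
apply: le_lt_trans cz; rewrite -raddfB; move: (c - z) => w.
have := normc_ge_Re (w * 'i%C); rewrite ReiNIm normrN normrM.
by rewrite [`|'i%C|]normc_def /= expr0n /= add0r expr1n sqrtr1 mulr1.
Qed.

(** The squared modulus as a real number: the topology of the complex numbers comes
from a norm with complex values, on which maxima are not available. *)
Definition sqnorm (c : C) : R := complex.Re c ^+ 2 + complex.Im c ^+ 2.

Lemma toC_sqnorm c : toC (sqnorm c) = `|c| ^+ 2.
Proof. exact: add_Re2_Im2. Qed.

Lemma sqnorm_ge0 c : 0 <= sqnorm c.
Proof. by rewrite addr_ge0 ?sqr_ge0. Qed.

Lemma sqnorm_eq0 c : (sqnorm c == 0) = (c == 0).
Proof.
by rewrite -(inj_eq (@toC_inj R)) toC_sqnorm rmorph0 expf_eq0 /= normr_eq0.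
Qed.

Lemma sqnormM c d : sqnorm (c * d) = sqnorm c * sqnorm d.
Proof. by apply: toC_inj; rewrite rmorphM /= !toC_sqnorm normrM exprMn. Qed.

Lemma sqnorm_toC (x : R) : sqnorm (toC x) = x ^+ 2.
Proof. by rewrite /sqnorm /= expr0n addr0. Qed.

Lemma continuous_sqnorm : continuous sqnorm.
Proof.
move=> c; apply: (cvgD (F := nbhs c)); under eq_fun do rewrite expr2; rewrite expr2.
  by apply: (cvgM (F := nbhs c)); exact: continuous_ReC.
by apply: (cvgM (F := nbhs c)); exact: continuous_ImC.
Qed.
End continuity.

Section span.
Variables (K : fieldType) (V : vectType K).

(** Take a finite family of elements of S whose span has the largest dimension. *)
Lemma exists_span (S : set V) : exists W : {vspace V}, S `<=` [set` W] /\
  forall U : {vspace V}, S `<=` [set` U] -> (W <= U)%VS.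
Proof.
pose P d := `[< exists2 s : seq V, (forall v, v \in s -> S v) & \dim (span s) = d >].
have exP : exists d, P d by exists 0%N; apply/asboolP; exists [::]; rewrite ?span_nil ?dimv0.
have ubP d : P d -> (d <= \dim {:V})%N.
  by move=> /asboolP[s _ <-]; exact: dimvS (subvf _).
case: (ex_maxnP exP ubP) => d /asboolP[s sS sd] dmax.
exists (span s); split=> [v /= Sv|U SU]; last first.
  by apply/span_subvP => v /sS; exact: SU.
have ss' : (span s <= span (v :: s))%VS by rewrite span_cons addvSr.
have : P (\dim (span (v :: s))).
  apply/asboolP; exists (v :: s) => // w.
  by rewrite in_cons => /orP[/eqP ->|/sS].
move=> /dmax; rewrite -sd => le_d.
have -> : span s = (span (v :: s)) by apply/eqP; rewrite eqEdim ss'.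
by apply: memv_span; rewrite mem_head.
Qed.
End span.

Section projective.
Variables (R : realType) (n : nat) (a : {vspace 'M[R]_n}).
Local Notation C := (Cplx R).
Local Notation dual := 'Hom(subvs_of a, R^o).
Variables (Q : 'M[C]_n) (lam : 'I_n -> dual).
Hypothesis QP : codiagonal Q lam.
Implicit Types (J : pred 'I_n) (z : 'cV[C]_n).

(** The squared norm of the component of z in the sum of the weight spaces selected
by [J]. *)
Definition weight_mass J z : R := \sum_(j | J j) sqnorm ((Q *m z) j 0).

Lemma weight_mass_ge0 J z : 0 <= weight_mass J z.
Proof. by apply: sumr_ge0 => j _; exact: sqnorm_ge0. Qed.

Lemma weight_mass_eq0 J z : weight_mass J z = 0 -> forall j, J j -> (Q *m z) j 0 = 0.
Proof.
move=> /eqP; rewrite psumr_eq0; last by move=> j _; exact: sqnorm_ge0.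
move=> /allP H j Jj; have := H j (mem_index_enum _).
by rewrite Jj /= sqnorm_eq0 => /eqP.
Qed.

Lemma weight_massZ J (c : C) z : weight_mass J (c *: z) = sqnorm c * weight_mass J z.
Proof.
by rewrite /weight_mass mulr_sumr; apply: eq_bigr => j _; rewrite -scalemxAr mxE sqnormM.
Qed.

Lemma weight_mass_total_gt0 z : z != 0 -> 0 < weight_mass predT z.
Proof.
move=> z0; rewrite lt_def weight_mass_ge0 andbT; apply: contraNneq z0.
move=> /weight_mass_eq0 Qz0; rewrite -[z]mul1mx -(codiagonal_VK QP) -mulmxA.
have -> : Q *m z = 0 by apply/matrixP => i k; rewrite ord1 Qz0 // mxE.
by rewrite mulmx0.
Qed.

Lemma continuous_weight_mass J : continuous (weight_mass J).
Proof.
move=> z; apply: (cvg_sum (F := nbhs z)) => j _.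
apply: (cvg_comp (fun z : 'cV[C]_n => (Q *m z) j 0) (@sqnorm R)); last exact: continuous_sqnorm.
rewrite mxE; under eq_fun do rewrite mxE.
apply: (cvg_sum (F := nbhs z)) => k _.
by apply: (cvgM (F := nbhs z)); [exact: cvg_cst|exact: coord_continuous].
Qed.

Lemma weight_mass_split J z : weight_mass predT z = weight_mass J z + weight_mass (predC J) z.
Proof. by rewrite /weight_mass (bigID J). Qed.

Definition mass_ratio J z : R := weight_mass J z / weight_mass predT z.

Lemma mass_ratioZ J (c : C) z : c != 0 -> mass_ratio J (c *: z) = mass_ratio J z.
Proof.
move=> c0; rewrite /mass_ratio !weight_massZ invfM mulrACA divff ?mul1r //.
by rewrite sqnorm_eq0.
Qed.

Definition proj_ratio J (x : projective_space R n) : R := mass_ratio J (set_val (repr x)).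

Lemma nonzero_vectorP (z : nonzero_vectors R n) : set_val z != 0.
Proof. exact: set_valP z. Qed.

Lemma pclass_eq (z w : nonzero_vectors R n) : pclass z = pclass w ->
  exists c : C, set_val z = c *: set_val w.
Proof.
move=> zw; have : (\pi_({eq_quot (proportional_equiv R n)}) z = \pi_({eq_quot (proportional_equiv R n)}) w)%qT by exact: zw.
by move=> /eqP; rewrite eqmodE => /asboolP.
Qed.

Lemma pclassK (x : projective_space R n) : pclass (repr x) = x.
Proof. by rewrite /pclass reprK. Qed.

Lemma proj_ratioE J (z : nonzero_vectors R n) : proj_ratio J (pclass z) = mass_ratio J (set_val z).
Proof.
rewrite /proj_ratio; have [c cE] := pclass_eq (pclassK (pclass z)).
rewrite cE mass_ratioZ //; apply/eqP => c0.
by have := nonzero_vectorP (repr (pclass z)); rewrite cE c0 scale0r eqxx.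
Qed.

Lemma continuous_proj_ratio J : continuous (proj_ratio J).
Proof.
apply/quotient_continuous.
rewrite (_ : _ \o _ = mass_ratio J \o set_val); last first.
  by apply/funext => z; exact: proj_ratioE.
move=> z; apply: (cvg_comp (set_val : nonzero_vectors R n -> 'cV[C]_n)).
  exact: (@initial_continuous (nonzero_vectors R n) _ set_val).
apply: (cvgM (F := nbhs (set_val z))); first exact: continuous_weight_mass.
apply: (cvgV (F := nbhs (set_val z))); last exact: continuous_weight_mass.
by rewrite gt_eqF // weight_mass_total_gt0 // nonzero_vectorP.
Qed.

Lemma nonzero_vector_of (w : 'cV[C]_n) : w != 0 -> exists z : nonzero_vectors R n, set_val z = w.
Proof. by move=> w0; exists (exist _ w (mem_set w0)). Qed.

(** Otherwise the span of the orbit would be a proper nonzero invariant subspace. *)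
Lemma orbit_mass_gt0 (S : set 'M[C]_n) (z : 'cV[C]_n) J j : acts_irreducibly S ->
  S 1%:M -> (forall g h, S g -> S h -> S (g *m h)) -> z != 0 -> J j ->
  exists2 g, S g & 0 < weight_mass J (g *m z).
Proof.
move=> [_ irrS] S1 SM z0 Jj; apply: contrapT => noS.
have Jz g i : S g -> J i -> (Q *m (g *m z)) i 0 = 0.
  move=> Sg; apply: weight_mass_eq0; apply/eqP; apply: contrapT => /negP g0.
  by apply: noS; exists g; rewrite // lt_def g0 weight_mass_ge0.
have [W [SW Wmin]] := @exists_span C 'cV[C]_n [set g *m z | g in S].
have Wz : z \in W by apply: SW; exists 1%:M => //; rewrite mul1mx.
have [g v Sg Wv||] := irrS W.
- have [phi phiE] : exists phi : 'Hom('cV[C]_n, 'cV[C]_n), forall x, phi x = g *m x.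
    by apply: linear_hom => d x y; rewrite mulmxDr -scalemxAr.
  have /subvP/(_ _ Wv) : (W <= phi @^-1: W)%VS.
    apply: Wmin => _ [h Sh <-] /=; rewrite -memv_preim phiE; apply: SW.
    by exists (g *m h); [exact: SM|rewrite mulmxA].
  by rewrite -memv_preim phiE.
- by move=> W0; move: Wz; rewrite W0 memv0 (negPf z0).
move=> Wfull.
have [psi psiE] : exists psi : 'Hom('cV[C]_n, C^o), forall x, psi x = (Q *m x) j 0.
  by apply: linear_hom => d x y; rewrite mulmxDr -scalemxAr !mxE.
have /subvP/(_ (Q^t* *m delta_mx j 0) (memvf _)) : (fullv <= lker psi)%VS.
  by rewrite -Wfull; apply: Wmin => _ [h Sh <-] /=; rewrite memv_ker psiE Jz.
rewrite memv_ker psiE mulmxA (codiagonal_KV QP) mul1mx mxE !eqxx /=.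
by rewrite oner_eq0.
Qed.

Lemma weight_mass_expmx J H z : weight_mass J (cmx (expmx (vsval H)) *m z) =
  \sum_(j | J j) expR (lam j H) ^+ 2 * sqnorm ((Q *m z) j 0).
Proof.
by apply: eq_bigr => j _; rewrite (codiagonal_expmx QP) sqnormM sqnorm_toC.
Qed.

(** exp(H) multiplies the mass in J by e^(2m) and every other mass by less. *)
Lemma mass_ratio_expmx J H (m : R) z :
  (forall j, J j -> lam j H = m) -> (forall j, ~~ J j -> lam j H < m) ->
  0 < weight_mass J z -> 0 < weight_mass (predC J) z ->
  mass_ratio J z < mass_ratio J (cmx (expmx (vsval H)) *m z).
Proof.
move=> HJ HJ' a0 b0; rewrite /mass_ratio !(weight_mass_split J).
set A := weight_mass J z in a0 *; set B := weight_mass _ z in b0 *.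
have -> : weight_mass J (cmx (expmx (vsval H)) *m z) = expR m ^+ 2 * A.
  by rewrite weight_mass_expmx mulr_sumr; apply: eq_bigr => j /HJ ->.
set B' := weight_mass _ (_ *m _).
have e0 : 0 < expR m ^+ 2 by rewrite exprn_gt0 // expR_gt0.
have B'0 : 0 <= B' by exact: weight_mass_ge0.
have B'B : B' < expR m ^+ 2 * B.
  have le_e j : ~~ J j -> expR (lam j H) ^+ 2 < expR m ^+ 2.
    by move=> /HJ' lm; rewrite ltr_pXn2r ?nnegrE ?expR_ge0 // ltr_expR.
  rewrite lt_def; apply/andP; split; last first.
    rewrite /B' weight_mass_expmx mulr_sumr; apply: ler_sum => j Jj.
    by rewrite ler_wpM2r ?sqnorm_ge0 // ltW // le_e.
  rewrite -subr_eq0 /B' weight_mass_expmx mulr_sumr -sumrB psumr_eq0; last first.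
    by move=> j Jj; rewrite -mulrBl mulr_ge0 ?sqnorm_ge0 // subr_ge0 ltW // le_e.
  apply: contraTN b0 => /allP H0; rewrite -leNgt le_eqVlt; apply/orP; left.
  rewrite /B /weight_mass psumr_eq0; last by move=> j _; exact: sqnorm_ge0.
  apply/allP => j jr; apply/implyP => Jj; have := H0 j jr; rewrite Jj /= -mulrBl mulf_eq0.
  by rewrite subr_eq0 gt_eqF // le_e.
rewrite ltr_pdivrMr ?addr_gt0 // mulrAC ltr_pdivlMr; last first.
  by rewrite ltr_pwDl // mulr_gt0.
have := B'B; rewrite -(ltr_pM2l a0).
by move: (expR m ^+ 2) A B B' {B'B B'0 a0 b0 e0} => e A B B'; lra.
Qed.

Lemma orbit_stable (S : set 'M[C]_n) (z0 z : nonzero_vectors R n) (g : 'M[C]_n) :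
  (forall g h, S g -> S h -> S (g *m h)) -> (forall g, S g -> g \in unitmx) ->
  S g -> Defs.orbit S z0 (pclass z) ->
  exists2 w : nonzero_vectors R n, Defs.orbit S z0 (pclass w) & set_val w = g *m set_val z.
Proof.
move=> SM Su Sg [u [h Sh uE] uz].
have [c cE] := pclass_eq uz.
have [w wE] : exists w : nonzero_vectors R n, set_val w = g *m set_val z.
  apply: nonzero_vector_of; apply: contra (nonzero_vectorP z) => /eqP gz.
  by rewrite -[set_val z](mulKmx (Su _ Sg)) gz mulmx0.
have [w' w'E] : exists w' : nonzero_vectors R n, set_val w' = g *m set_val u.
  apply: nonzero_vector_of; apply: contra (nonzero_vectorP u) => /eqP gz.
  by rewrite -[set_val u](mulKmx (Su _ Sg)) gz mulmx0.
exists w => //; exists w'; first by exists (g *m h); [exact: SM|rewrite w'E uE mulmxA].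
have : (w' == w %[mod {eq_quot (proportional_equiv R n)}])%qT.
  by rewrite eqmodE; apply/asboolP; exists c; rewrite w'E wE cE -scalemxAr.
by move=> /eqP ?.
Qed.

Lemma support_eigenvector (l : dual) z :
  (forall j, lam j != l -> (Q *m z) j 0 = 0) ->
  forall H, cmx (vsval H) *m z = toC (l H) *: z.
Proof.
move=> supp H; rewrite -[LHS]mul1mx -[z in RHS]mul1mx -(codiagonal_VK QP) -!mulmxA scalemxAr.
congr (_ *m _); apply/matrixP => i k; rewrite ord1 (codiagonal_coord QP) [RHS]mxE.
by have [->|/supp ->] := eqVneq (lam i) l; rewrite ?mulr0.
Qed.

(** At a point of the orbit where the mass ratio is maximal, no mass can be left
outside J, since exp(H) would increase the ratio. *)
Lemma compact_orbit_weight (S : set 'M[C]_n) (O : set (projective_space R n)) J H (m : R) j :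
  acts_irreducibly S -> S 1%:M -> (forall g h, S g -> S h -> S (g *m h)) ->
  (forall g, S g -> g \in unitmx) -> is_compact_orbit S O ->
  S (cmx (expmx (vsval H))) ->
  J j -> (forall j, J j -> lam j H = m) -> (forall j, ~~ J j -> lam j H < m) ->
  exists2 z : nonzero_vectors R n, O (pclass z) &
    forall j, ~~ J j -> (Q *m set_val z) j 0 = 0.
Proof.
move=> irrS S1 SM Su [Oc [z0 OE]] SH Jj HJ HJ'.
have mulS g (z : nonzero_vectors R n) : S g -> O (pclass z) ->
    exists2 w : nonzero_vectors R n, O (pclass w) & set_val w = g *m set_val z.
  by rewrite OE; exact: orbit_stable.
have Oz0 : O (pclass z0).
  by rewrite OE; exists z0 => //; exists 1%:M => //; rewrite mul1mx.
have [g Sg gz0] := orbit_mass_gt0 irrS S1 SM (nonzero_vectorP z0) Jj.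
have [w Ow wE] := mulS g z0 Sg Oz0.
have [] := @compact_EVT_max _ R (proj_ratio J) O.
- by exists (pclass w).
- exact: Oc.
- by apply: continuous_subspaceT; exact: continuous_proj_ratio.
move=> x /set_mem Ox xmax.
have [z zE] : exists z : nonzero_vectors R n, x = pclass z by move: Ox; rewrite OE => -[z _ <-]; exists z.
rewrite zE {x zE} in Ox xmax; exists z => // i Ji.
apply: (@weight_mass_eq0 (predC J)) => //; apply/eqP; apply: contraT => b0.
have {}b0 : 0 < weight_mass (predC J) (set_val z) by rewrite lt_def b0 weight_mass_ge0.
have a0 : 0 < weight_mass J (set_val z).
  have mw : 0 < mass_ratio J (set_val w).
    by apply: divr_gt0; [rewrite wE|apply: weight_mass_total_gt0; exact: nonzero_vectorP].
  have := lt_le_trans mw; rewrite -!proj_ratioE => /(_ _ (xmax _ (mem_set Ow))).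
  rewrite proj_ratioE /mass_ratio pmulr_lgt0 // invr_gt0.
  by apply: weight_mass_total_gt0; exact: nonzero_vectorP.
have [z' Oz' z'E] := mulS _ z SH Ox.
have := xmax _ (mem_set Oz'); rewrite !proj_ratioE z'E leNgt.
by rewrite (mass_ratio_expmx HJ HJ').
Qed.

End projective.

(** * The gradient map at weight vectors *)

Section gradient.
Variables (R : realType) (n : nat) (G : set 'M[R]_n).
Local Notation C := (Cplx R).
Hypotheses (subG : is_subgroup_SL G) (closedG : closed G).
Local Notation K := (orthogonal_part G).
Local Notation p := (symmetric_part G).
Variable (a : {vspace 'M[R]_n}).
Hypothesis maxa : maximal_abelian_in p a.
Local Notation dual := 'Hom(subvs_of a, R^o).
Variables (Q : 'M[C]_n) (lam : 'I_n -> dual).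
Hypothesis QP : codiagonal Q lam.
Variables (ip : 'M[C]_n -> 'M[C]_n -> R) (mu : projective_space R n -> 'M[R]_n) (c : R).
Hypotheses (c_gt0 : 0 < c) (ipE : forall A B, p A -> p B -> ip (cmx A) (cmx B) = c * \tr (A *m B)).
Hypothesis muP : is_gradient_map ip p mu.
Implicit Types (z w : nonzero_vectors R n) (H : subvs_of a).

Lemma sym_trace_eq0 (X : 'M[R]_n) : X^T = X -> \tr (X *m X) = 0 -> X = 0.
Proof.
move=> Xs X0; apply/eqP; apply: contraT => /trace_gram_gt0.
by rewrite Xs X0 ltxx.
Qed.

Lemma symmetric_part_sym X : p X -> X^T = X.
Proof. by case=> _ []. Qed.

Lemma gradientE z b : p b -> toC (c * \tr (mu (pclass z) *m b)) =
  ((set_val z)^t* *m cmx b *m set_val z) 0 0 / \sum_i `|set_val z i 0| ^+ 2.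
Proof. by move=> pb; case: muP => pmu muE; rewrite -ipE // muE. Qed.

(** Let m be the value of the gradient map and B in a. Then Y = [B, m] is in g and
skew, and [Y, B] is in p, so tr(m [Y, B]) is proportional to z^* [Y, B] z, which
is 0 as z is an eigenvector of B. But tr(m [Y, B]) = tr(Y Y), whence Y = 0 and m
commutes with a. By maximality m is in a, where it is determined by the
weight. *)
Lemma gradient_weight_vector z (l : dual) (x : 'M[R]_n) :
  (forall H, cmx (vsval H) *m set_val z = toC (l H) *: set_val z) ->
  x \in a -> (forall H, c * \tr (x *m vsval H) = l H) -> mu (pclass z) = x.
Proof.
move=> zl xa xl; set m := mu (pclass z).
have pm : p m by case: muP => pmu _; exact: pmu.
have N0 : \sum_i `|set_val z i 0| ^+ 2 != 0.
  rewrite -(codiagonal_norm QP); under eq_bigr do rewrite -toC_sqnorm.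
  rewrite -rmorph_sum -(rmorph0 (@toC R)) (inj_eq (@toC_inj R)).
  by rewrite gt_eqF // (weight_mass_total_gt0 QP) // nonzero_vectorP.
have zN : ((set_val z)^t* *m set_val z) 0 0 = \sum_i `|set_val z i 0| ^+ 2.
  by rewrite mxE; apply: eq_bigr => i _; rewrite normCK 2!mxE mulrC.
have zl' H : (set_val z)^t* *m cmx (vsval H) = toC (l H) *: (set_val z)^t*.
  have Hs : (vsval H)^T = vsval H by exact: (maximal_abelian_sym maxa (subvsP H)).
  have /(congr1 (fun v => v^t*)) := zl H.
  rewrite trmx_mul map_mxM /= cmx_adj Hs => ->.
  by rewrite linearZ /= map_mxZ; congr (_ *: _); exact: conj_toC.
have mH H : c * \tr (m *m vsval H) = l H.
  apply: toC_inj; rewrite gradientE; last exact: maximal_abelian_sub (subvsP H).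
  by rewrite zl' -scalemxAl mxE zN mulfK.
have ma : m \in a.
  apply: (maximal_abelian_self_centralizing subG closedG maxa) => // B Ba.
  have pB : p B by exact: maximal_abelian_sub maxa _ Ba.
  apply/bracket_eq0; rewrite -[bracket _ _]opprK; apply/eqP; rewrite oppr_eq0; apply/eqP.
  set Y := - bracket m B.
  have YE : Y = bracket B m by rewrite /Y /bracket opprB.
  have gY : lie_algebra G Y by rewrite YE; apply: lie_algebra_bracket => //; [case: pB|case: pm].
  have Ys : Y^T = - Y by rewrite YE; exact: (bracket_sym_sym pB pm).
  have pYB := bracket_skew_sym subG closedG gY Ys pB.
  have H0 : \tr (m *m bracket Y B) = 0.
    apply: (mulfI (lt0r_neq0 c_gt0)); rewrite mulr0; apply: toC_inj; rewrite rmorph0 gradientE //.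
    rewrite /bracket cmxB !cmxM -(vsprojK Ba) mulmxBr mulmxBl.
    rewrite !mulmxA zl' -[_ *m cmx Y *m cmx _ *m _]mulmxA zl -!scalemxAl -!scalemxAr.
    by rewrite subrr mxE mul0r.
  have : \tr (Y^T *m Y) = 0.
    rewrite Ys mulNmx mxtraceN; apply/eqP; rewrite oppr_eq0; apply/eqP.
    rewrite -[RHS]H0 {2}YE /bracket !mulmxBr !mxtraceB !mulmxA.
    by rewrite [\tr (Y *m B *m m)]mxtrace_mulC -[Y *m m *m B]mulmxA [\tr (Y *m (m *m B))]mxtrace_mulC !mulmxA.
  by move=> YY0; apply/eqP; apply: contraT => /trace_gram_gt0; rewrite YY0 ltxx.
have da : m - x \in a by rewrite rpredB.
apply/eqP; rewrite -subr_eq0; apply/eqP; apply: sym_trace_eq0.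
  exact: (maximal_abelian_sym maxa).
apply: (mulfI (lt0r_neq0 c_gt0)); rewrite mulr0 mulmxBl mxtraceB mulrBr.
by rewrite -(vsprojK da) mH xl subrr.
Qed.

Lemma gradient_equivariant k z w : K k -> set_val w = cmx k *m set_val z ->
  mu (pclass w) = k *m mu (pclass z) *m k^T.
Proof.
move=> Kk wE; have [Gk kk kk' kV] := orthogonal_partP Kk.
have pm u : p (mu u) by case: muP => pmu _; exact: pmu.
have pk : p (k *m mu (pclass z) *m k^T) by exact: symmetric_part_Ad.
set m := mu (pclass w); set m' := k *m _ *m _.
have pd : p (m - m') by apply: symmetric_partB => //; exact: pm.
apply/eqP; rewrite -subr_eq0; apply/eqP; apply: sym_trace_eq0; first exact: symmetric_part_sym.
apply: (mulfI (lt0r_neq0 c_gt0)); rewrite mulr0 mulmxBl mxtraceB mulrBr.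
move: (m - m') pd => b pb; apply/eqP; rewrite subr_eq0; apply/eqP.
have -> : \tr (m' *m b) = \tr (mu (pclass z) *m (k^T *m b *m k)).
  by rewrite /m' -!mulmxA mxtrace_mulC !mulmxA.
have pb' : p (k^T *m b *m k).
  by rewrite -{2}[k]trmxK; apply: symmetric_part_Ad => //; exact: orthogonal_part_tr.
have zN (v : 'cV[C]_n) : \sum_i `|v i 0| ^+ 2 = (v^t* *m v) 0 0.
  by rewrite mxE; apply: eq_bigr => i _; rewrite normCK 2!mxE mulrC.
have wE' : (set_val w)^t* = (set_val z)^t* *m cmx k^T.
  by rewrite wE trmx_mul map_mxM /= cmx_adj.
apply: toC_inj; rewrite !gradientE // !zN wE' wE !cmxM !mulmxA.
by rewrite -[_ *m cmx k^T *m cmx k]mulmxA -cmxM kk cmx1 mulmx1.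
Qed.

Lemma gradient_le z H (M : R) : (forall j, lam j H <= M) ->
  c * \tr (mu (pclass z) *m vsval H) <= M.
Proof.
move=> leM; rewrite -ler_toC gradientE; last exact: maximal_abelian_sub maxa _ (subvsP H).
rewrite (codiagonal_form QP) -(codiagonal_norm QP).
under eq_bigr do rewrite -toC_sqnorm -rmorphM /=.
under [X in _ / X]eq_bigr do rewrite -toC_sqnorm.
rewrite -!rmorph_sum -fmorphV -rmorphM ler_toC ler_pdivrMr; last first.
  exact: (weight_mass_total_gt0 QP (nonzero_vectorP z)).
rewrite mulr_sumr; apply: ler_sum => j _.
by rewrite ler_wpM2r // sqnorm_ge0.
Qed.
End gradient.

(** * The momentum polytope *)

Section hull.
Variables (R : realType) (n : nat) (a : {vspace 'M[R]_n}).
Local Notation dual := 'Hom(subvs_of a, R^o).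
Hypothesis n_gt0 : (0 < n)%N.
Hypothesis syma : forall X, X \in a -> X^T = X.
Variables (Q : 'M[Cplx R]_n) (lam : 'I_n -> dual).
Hypothesis QP : codiagonal Q lam.
Variables (W : set 'M[R]_n) (c : R).
Hypotheses (c_gt0 : 0 < c) (W0 : W !=set0).
Hypothesis Wweight : forall q, W q -> q \in a /\
  exists2 l : dual, is_weight l & forall H, c * \tr (q *m vsval H) = l H.

(** W is finite, because each of its elements is determined by the weight that it
represents. A strictly separating normal z remains separating after a small
perturbation that makes it regular. *)
Lemma convex_hull_criterion (y : 'M[R]_n) : y \in a ->
  (forall H : subvs_of a, regular lam H ->
     exists2 q, W q & c * \tr (y *m vsval H) <= c * \tr (q *m vsval H)) ->
  convex_hull W y.
Proof.
move=> ya bound; have [x0 Wx0] := W0.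
pose repr_lam j q := forall H, c * \tr (q *m vsval H) = lam j H.
(* an enumeration of W by the indices of the weights, with x0 as a default value *)
have /choice[q qP] : forall j, exists q, W q /\ ((exists2 q', W q' & repr_lam j q') -> repr_lam j q).
  move=> j; have [[q Wq qj]|no] := pselect (exists2 q', W q' & repr_lam j q').
    by exists q.
  by exists x0; split=> // /no.
have qW j : W (q j) by have [] := qP j.
have Wq q' : W q' -> exists j, q' = q j.
  move=> Wq'; have [q'a [l wl q'l]] := Wweight Wq'.
  have [j lj] := codiagonal_weight QP wl; exists j.
  have q'j : repr_lam j q' by move=> H; rewrite q'l lj.
  have qj : repr_lam j (q j) by have [_] := qP j; apply; exists q'.
  have da : q' - q j \in a by rewrite rpredB //; have [] := Wweight (qW j).
  apply/eqP; rewrite -subr_eq0; apply/eqP; apply: sym_trace_eq0; first exact: syma.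
  apply: (mulfI (lt0r_neq0 c_gt0)); rewrite mulr0 mulmxBl mxtraceB mulrBr.
  by rewrite -(vsprojK da) q'j qj subrr.
have hullC : convex_set (convex_hull W) by exact: convex_hull_convex.
case: (separation q y n_gt0) => -[t [t0 t1]].
  move=> ->; apply: convex_set_sum => // i; exact: convex_hull_sub.
set z := y - _ => sep.
have za : z \in a.
  rewrite rpredB // rpred_sum // => i _; rewrite rpredZ //.
  by have [] := Wweight (qW i).
rewrite (syma za) in sep.
have [H1 reg1] := regular_exists lam.
have domN : \forall e \near 0^'+, forall i, i \in enum 'I_n ->
    0 < (\tr (z *m y) - \tr (z *m q i)) + e * (\tr (vsval H1 *m y) - \tr (vsval H1 *m q i)).
  by apply: near_seq => i _; apply: near_affine_gt0; rewrite subr_gt0.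
have /filter_ex[e [rege dome]] : \forall e \near 0^'+,
    regular lam (vsproj a z + e *: H1) /\ forall i, i \in enum 'I_n ->
    0 < (\tr (z *m y) - \tr (z *m q i)) + e * (\tr (vsval H1 *m y) - \tr (vsval H1 *m q i)).
  by apply: filterI => //; exact: regular_near.
have [_ /Wq[i ->]] := bound _ rege.
have := dome i (mem_enum _ _).
have -> : vsval (vsproj a z + e *: H1) = z + e *: vsval H1.
  by rewrite linearD linearZ /= vsprojK.
rewrite ler_pM2l // [\tr (y *m _)]mxtrace_mulC [\tr (q i *m _)]mxtrace_mulC !mulmxDl -!scalemxAl.
rewrite !mxtraceD !mxtraceZ.
lra.
Qed.
End hull.

Theorem proposition5 (R : realType) (n : nat) (G : set 'M[R]_n)
  (ip : 'M[Cplx R]_n -> 'M[Cplx R]_n -> R)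
  (O' O : set (projective_space R n))
  (mu : projective_space R n -> 'M[R]_n)
  (a : {vspace 'M[R]_n}) (Pi : seq 'Hom(subvs_of a, R^o))
  (mu_rho : 'Hom(subvs_of a, R^o)) (x_rho : 'M[R]_n) :
  is_subgroup_SL G -> closed G -> connected G -> ~ compact G ->
  semisimple_algebra (lie_algebra G) ->
  G = [set k *m expmx x | k in orthogonal_part G & x in symmetric_part G] ->
  acts_irreducibly G ->
  acts_irreducibly [set cmx x | x in G] ->
  is_compact_orbit (zariski_closure [set cmx x | x in G]) O' ->
  is_compact_orbit [set cmx x | x in G] O -> O `<=` O' ->
  AdSU_scalar_product ip ->
  is_gradient_map ip (symmetric_part G) mu ->
  maximal_abelian_in (symmetric_part G) a ->
  is_base (lie_algebra G) Pi ->
  is_highest_weight Pi mu_rho ->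
  represents ip x_rho mu_rho ->
  momentum_polytope mu O a = convex_hull (weyl_orbit (orthogonal_part G) a x_rho)
  /\
  forall (l : 'Hom(subvs_of a, R^o)) (x : 'M[R]_n), is_weight l -> represents ip x l ->
    convex_hull (weyl_orbit (orthogonal_part G) a x_rho) x.
Proof.
move=> subG closedG _ _ _ cartan [n_gt0 _] irrC _ orbO _ ipP muP maxa basePi hwP [xa xP].
have syma X : X \in a -> X^T = X by exact: maximal_abelian_sym maxa X.
have aab : is_abelian a by case: maxa.
have pa X : X \in a -> symmetric_part G X by exact: maximal_abelian_sub maxa X.
have [Q [lam QP]] := exists_codiagonal syma aab.
have [c c0 ipE] : exists2 c : R, 0 < c & forall A B, symmetric_part G A -> symmetric_part G B ->
    ip (cmx A) (cmx B) = c * \tr (A *m B).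
  have [c c0 H] := ip_trace n_gt0 ipP; exists c => // A B [_ [As A0]] [_ [Bs B0]].
  exact: H.
have reprE (l : 'Hom(subvs_of a, R^o)) (x : 'M[R]_n) : represents ip x l ->
    x \in a /\ forall H : subvs_of a, c * \tr (x *m vsval H) = l H.
  move=> [x_a xl]; split; first exact: x_a.
  move=> H; rewrite -xl ipE //; apply: pa => //; exact: subvsP.
have {xP} xP := (reprE _ _ (conj xa xP)).2.
set W := weyl_orbit _ a x_rho.
have Wbound H := weight_le_orbit subG closedG cartan maxa QP basePi hwP xP (H := H).
have Wweight q (Wq : W q) := weyl_orbit_weight subG hwP xP xa Wq.
have N1 : normalizer (orthogonal_part G) a 1%:M.
  apply: normalizer_of_stable; first exact: orthogonal_part1.
  by move=> B Ba; rewrite trmx1 mul1mx mulmx1.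
have W0 : W !=set0 by exists (1%:M *m x_rho *m invmx 1%:M); exists 1%:M.
have crit := convex_hull_criterion n_gt0 syma QP c0 W0 Wweight.
split; last first.
  move=> l x wl /reprE[x_a xl]; apply: crit => // H /Wbound[q Wq qb].
  by exists q => //; rewrite xl; exact: qb.
apply/seteqP; split=> [y [yE ya]|].
  apply: crit => // H /Wbound[q Wq qb]; exists q => //.
  rewrite ler_pM2l //; set M := \tr (q *m _).
  suff : convex_hull (mu @` O) `<=` [set x | \tr (x *m vsval H) <= M] by move=> /(_ y yE).
  apply: convex_hull_min; first exact: convex_halfspace.
  move=> _ [t Ot <-] /=; rewrite -(ler_pM2l c0) -(pclassK t).
  by apply: (gradient_le maxa QP ipE muP) => j; apply: qb; exact: is_weight_lam QP j.
have [freePi _ _] := basePi.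
have [H' reg' dom'] := regular_dominant_exists lam freePi.
have [j0 j0E] := codiagonal_weight QP hwP.1.
pose S : set 'M[Cplx R]_n := [set cmx x | x in G].
have [G1 GM GV Gdet] := subG.
have S1 : S 1%:M by exists 1%:M => //; exact: cmx1.
have SM g h : S g -> S h -> S (g *m h).
  by move=> [x Gx <-] [y Gy <-]; exists (x *m y); [exact: GM|exact: cmxM].
have Su g : S g -> g \in unitmx.
  by move=> [x Gx <-]; rewrite map_unitmx unitmxE Gdet // unitr1.
have [z Oz zsupp] : exists2 z : nonzero_vectors R n, O (pclass z) &
    forall j, lam j != mu_rho -> (Q *m set_val z) j 0 = 0.
  apply: (@compact_orbit_weight _ _ _ _ _ QP S O (fun j => lam j == mu_rho) H' (mu_rho H') j0) => //.
  - exists (expmx (vsval H')) => //; apply: lie_algebra_exp.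
    by have [] := pa _ (subvsP H').
  - by rewrite j0E.
  - by move=> j /eqP ->.
  (* mu_rho dominates every weight at H', and strictly so because H' is regular *)
  - move=> j lj; rewrite lt_neqAle; apply/andP; split.
      by apply: contra lj => /eqP; rewrite {1}j0E => /reg' ->; rewrite j0E.
    have [d d0 ->] := hwP.2 _ (is_weight_lam QP j).
    rewrite lfunE /= lfunE /= lerBlDr lerDl sum_lfunE big_seq sumr_ge0 // => s sPi.
    by rewrite lfunE /= mulr_ge0 ?d0 // ltW // dom'.
have muz : mu (pclass z) = x_rho.
  apply: (gradient_weight_vector subG closedG maxa QP c0 ipE muP _ xa xP).
  exact: (support_eigenvector QP zsupp).
move=> y yW; split; last first.
  suff : convex_hull W `<=` [set` a] by move=> /(_ y yW).
  by apply: convex_hull_min; [exact: convex_vspace|move=> q /Wweight[]].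
suff : convex_hull W `<=` convex_hull (mu @` O) by move=> /(_ y yW).
apply: convex_hull_min; first exact: convex_hull_convex.
move=> _ [k [Kk _] <-]; apply: convex_hull_sub.
have [Gk _ _ ->] := orthogonal_partP Kk.
have [_ [z0 OE]] := orbO.
have [w Ow wE] : exists2 w, O (pclass w) & set_val w = cmx k *m set_val z.
  by rewrite OE in Oz *; apply: orbit_stable Oz => //; exists k.
exists (pclass w) => //.
by rewrite (gradient_equivariant subG closedG c0 ipE muP Kk wE) muz.
Qed.
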